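(* Let $\{\Phi_t\}_{t\ge 0}$ be a primitive quantum Markov semigroup on $M_n(\mathbb{C})$ with generator $\mathcal{L}$ that is KMS-symmetric with respect to its faithful invariant state $\rho$. Then $$\frac{h_\rho(\mathcal{L})^2\, s_-^2}{2 s_+^2\,\|\mathcal{L}\|_{\mathrm{KMS},\rho}} \;\le\; \lambda_{\mathrm{KMS}} \;\le\; \left(\sqrt{\frac{s_-}{s_+}}+\sqrt{\frac{s_+}{s_-}}\right) h_\rho(\mathcal{L}).$$
   Context: Throughout $n\ge 2$ and $M_n(\mathbb{C})$ carries the unnormalized trace $\mathrm{Tr}$. A quantum Markov semigroup is a norm-continuous semigroup $\{\Phi_t\}_{t\ge0}$ of unital completely positive linear maps on $M_n(\mathbb{C})$ with $\Phi_0=\mathrm{Id}$; its generator $\mathcal{L}$ is defined by $\Phi_t=e^{-t\mathcal{L}}$. A faithful state $\rho$ has positive definite density matrix $D_\rho$, $\rho(X)=\mathrm{Tr}(D_\rho X)$; $s_-$ and $s_+$ are the smallest and largest eigenvalues of $D_\rho$. The KMS inner product is $\langle X,Y\rangle_{\mathrm{KMS},\rho}=\mathrm{Tr}(X^*D_\rho^{1/2}YD_\rho^{1/2})$, with norm $\|X\|_{\mathrm{KMS},\rho}$; for a linear map, $\|\mathcal{L}\|_{\mathrm{KMS},\rho}=\sup_{X\ne0}\|\mathcal{L}(X)\|_{\mathrm{KMS},\rho}/\|X\|_{\mathrm{KMS},\rho}$. The semigroup is KMS-symmetric with respect to $\rho$ if $\langle X,\Phi_t(Y)\rangle_{\mathrm{KMS},\rho}=\langle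 \Phi_t(X),Y\rangle_{\mathrm{KMS},\rho}$ for all $t\ge0$ and all $X,Y$. It is primitive if it admits a faithful invariant state and $\ker\mathcal{L}=\mathbb{C}I$; $\rho$ is then the unique invariant state. Projection Dirichlet conductance: $h_\rho(\mathcal{L})=\inf_{P}\dfrac{\langle P,\mathcal{L}(P)\rangle_{\mathrm{KMS},\rho}}{\min\{\rho(P),1-\rho(P)\}}$, the infimum over all orthogonal projections $P\in M_n(\mathbb{C})$ with $P\ne0,I$. Spectral gap: $\lambda_{\mathrm{KMS}}=\inf\left\{\dfrac{\langle X,\mathcal{L}(X)\rangle_{\mathrm{KMS},\rho}}{\|X\|_{\mathrm{KMS},\rho}^2}: 0\ne X=X^*\in M_n(\mathbb{C}),\ \rho(X)=0\right\}$. *)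

(* Defs.v *)
From HB Require Import structures.
From mathcomp Require Import all_boot all_order all_algebra.
From mathcomp Require Import complex.
From mathcomp Require Import all_classical all_reals all_analysis.

Set Implicit Arguments.
Unset Strict Implicit.
Unset Printing Implicit Defensive.

Import Order.TTheory GRing.Theory Num.Theory.
Import numFieldNormedType.Exports.

Local Open Scope classical_set_scope.
Local Open Scope ring_scope.
Local Open Scope complex_scope.
Local Open Scope sesquilinear_scope.

(* In the order of R[i], [0 <= z] and [0 < z] include that z is real; hence the
   two positivity predicates below force A to be Hermitian. *)
Definition psdmx (R : realType) (m : nat) (A : 'M[R[i]]_m) : Prop :=
  forall v : 'cV[R[i]]_m, 0 <= (v^t* *m A *m v) ord0 ord0.

Definition posdefmx (R : realType) (m : nat) (A : 'M[R[i]]_m) : Prop :=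
  forall v : 'cV[R[i]]_m, v != 0 -> 0 < (v^t* *m A *m v) ord0 ord0.

(* Square root by functional calculus in an orthonormal eigenbasis; it is the
   positive square root when A is positive semidefinite. *)
Definition sqrtmx (R : realType) (n : nat) (A : 'M[R[i]]_n) : 'M[R[i]]_n :=
  invmx (spectralmx A) *m diag_mx (map_mx sqrtC (spectral_diag A))
    *m spectralmx A.

(* The set is bounded above, so that [sup] is the true supremum, as soon as T is
   linear and nrm is a norm on matrices of positive size. *)
Definition opnorm (R : realType) (n : nat) (nrm : 'M[R[i]]_n -> R)
    (T : 'M[R[i]]_n -> 'M[R[i]]_n) : R :=
  sup [set nrm (T X) / nrm X | X in [set X : 'M[R[i]]_n | X != 0]].

Definition hs_norm (R : realType) (n : nat) (X : 'M[R[i]]_n) : R :=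
  Num.sqrt (complex.Re (\tr (X^t* *m X))).

(* Positivity of (Phi applied blockwise) on the k x k block matrices with
   n x n blocks, that is on M_k (M_n), for every k. *)
Definition completely_positive (R : realType) (n : nat)
    (Phi : 'M[R[i]]_n -> 'M[R[i]]_n) : Prop :=
  forall (k : nat) (B : 'I_k -> 'I_k -> 'M[R[i]]_n),
    psdmx (\mxblock_(i < k, j < k) B i j) ->
    psdmx (\mxblock_(i < k, j < k) Phi (B i j)).

(* Only the values of Phi at times t >= 0 matter. Superoperators are measured in
   the operator norm induced by the Hilbert-Schmidt norm; in finite dimension
   any other choice of norm gives the same topology. *)
Record quantum_markov_semigroup (R : realType) (n : nat)
    (Phi : R -> {linear 'M[R[i]]_n -> 'M[R[i]]_n}) : Prop := {
  qms_cp : forall t : R, 0 <= t -> completely_positive (Phi t);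
  qms_unital : forall t : R, 0 <= t -> Phi t 1%:M = 1%:M;
  qms_zero : forall X, Phi 0 X = X;
  qms_add : forall s t : R, 0 <= s -> 0 <= t ->
    forall X, Phi (s + t) X = Phi s (Phi t X);
  qms_continuous : forall t : R, 0 <= t ->
    opnorm (@hs_norm R n) (fun X => Phi s X - Phi t X)
      @[s --> within [set s : R | 0 <= s] (nbhs t)] --> (0 : R) }.

(* Phi_t = exp(- t L) for t >= 0, the exponential series being convergent in
   operator norm. *)
Definition is_generator (R : realType) (n : nat)
    (Phi : R -> {linear 'M[R[i]]_n -> 'M[R[i]]_n})
    (L : {linear 'M[R[i]]_n -> 'M[R[i]]_n}) : Prop :=
  forall t : R, 0 <= t ->
    opnorm (@hs_norm R n)
      (fun X => Phi t X - \sum_(k < N) ((- t) ^+ k / k`!%:R)%:C *: iter k L X)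
      @[N --> \oo] --> (0 : R).

(* States on M_n are represented by their density matrices. *)
Definition faithful_state (R : realType) (n : nat) (D : 'M[R[i]]_n) : Prop :=
  posdefmx D /\ \tr D = 1.

Definition state_ev (R : realType) (n : nat) (D X : 'M[R[i]]_n) : R[i] :=
  \tr (D *m X).

Definition invariant_state (R : realType) (n : nat)
    (Phi : R -> {linear 'M[R[i]]_n -> 'M[R[i]]_n}) (D : 'M[R[i]]_n) : Prop :=
  forall t : R, 0 <= t -> forall X, state_ev D (Phi t X) = state_ev D X.

Definition primitive_qms (R : realType) (n : nat)
    (Phi : R -> {linear 'M[R[i]]_n -> 'M[R[i]]_n})
    (L : {linear 'M[R[i]]_n -> 'M[R[i]]_n}) : Prop :=
  (exists D : 'M[R[i]]_n, faithful_state D /\ invariant_state Phi D) /\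
  (forall X, L X = 0 <-> exists c : R[i], X = c%:M).

Definition kms_inner (R : realType) (n : nat) (D X Y : 'M[R[i]]_n) : R[i] :=
  \tr (X^t* *m sqrtmx D *m Y *m sqrtmx D).

Definition kms_norm (R : realType) (n : nat) (D X : 'M[R[i]]_n) : R :=
  Num.sqrt (complex.Re (kms_inner D X X)).

Definition kms_symmetric (R : realType) (n : nat)
    (Phi : R -> {linear 'M[R[i]]_n -> 'M[R[i]]_n}) (D : 'M[R[i]]_n) : Prop :=
  forall t : R, 0 <= t ->
    forall X Y, kms_inner D X (Phi t Y) = kms_inner D (Phi t X) Y.

Definition min_eigenvalue (R : realType) (n : nat) (D : 'M[R[i]]_n) : R :=
  inf [set s : R | eigenvalue D s%:C].

Definition max_eigenvalue (R : realType) (n : nat) (D : 'M[R[i]]_n) : R :=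
  sup [set s : R | eigenvalue D s%:C].

Definition orth_projection (R : realType) (n : nat) (P : 'M[R[i]]_n) : Prop :=
  P^t* = P /\ P *m P = P.

(* In the two infima, P, X, L P, L X and D are Hermitian, so that the complex
   numbers whose real parts are taken are in fact real; [complex.Re] only
   transports them to R. *)
Definition conductance (R : realType) (n : nat) (D : 'M[R[i]]_n)
    (L : 'M[R[i]]_n -> 'M[R[i]]_n) : R :=
  inf [set complex.Re (kms_inner D P (L P)) /
           Num.min (complex.Re (state_ev D P)) (1 - complex.Re (state_ev D P))
      | P in [set P : 'M[R[i]]_n | [/\ orth_projection P, P != 0 & P != 1%:M]]].

Definition spectral_gap (R : realType) (n : nat) (D : 'M[R[i]]_n)
    (L : 'M[R[i]]_n -> 'M[R[i]]_n) : R :=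
  inf [set complex.Re (kms_inner D X (L X)) / kms_norm D X ^+ 2
      | X in [set X : 'M[R[i]]_n | [/\ X != 0, X^t* = X & state_ev D X = 0]]].

(* Main.v *)
(* For each t the map Phi_t is unital, completely positive and KMS-symmetric, and
   then <X, X - Phi_t X>_KMS = sum_m ||[V_m, X]||_KMS^2 for suitable V_m.  In an
   eigenbasis of S = D^(1/2) the Gram matrix of (V_m) is the Choi matrix of Phi_t
   divided entrywise by sums a_p + a_q with a > 0, so it solves a Lyapunov
   equation with positive right-hand side and is itself positive.

   The KMS norm lies between s_-^(1/2) and s_+^(1/2) times the Hilbert-Schmidt
   norm, and in an eigenbasis of X = sum_k x_k P_k the Hilbert-Schmidt commutator
   form is a classical Dirichlet form sum_kl w_kl (x_k - x_l)^2 with w >= 0.  The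
   classical Cheeger argument (layer cake for f|f|, where f = x - median, and
   Cauchy-Schwarz) applies to it.  The resulting inequality involves only finitely
   many values of the KMS form, hence survives division by t^2 and t -> 0.

   The upper bound tests the gap on P - rho(P): comparing s_i^(1/2) s_j^(1/2) with
   (s_i + s_j) / 2 bounds ||P - rho(P)||_KMS^2 below by a multiple of
   rho(P) (1 - rho(P)). *)

Require Import Defs.
From HB Require Import structures.
From mathcomp Require Import all_boot all_order all_algebra.
From mathcomp Require Import ring lra.
From mathcomp Require Import complex.
From mathcomp Require Import all_classical all_reals all_analysis.

Set Implicit Arguments.
Unset Strict Implicit.
Unset Printing Implicit Defensive.

Import Order.TTheory GRing.Theory Num.Theory.
Import numFieldNormedType.Exports.
Local Open Scope classical_set_scope.
Local Open Scope ring_scope.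
Local Open Scope sesquilinear_scope.

(** [D] and X need not commute, so the KMS weights s_i^(1/2) s_j^(1/2) and the eigenvalues of X do
    not become diagonal together. The weights, which lie in [s_-, s_+], are therefore given up: <X,
    X - Phi_t X> is trapped between s_- and s_+ times one classical Dirichlet form, the same for all
    functions of X. In the Cheeger argument the layers need the upper estimate and their sum gets
    squared, which costs s_+^2; the form at f and the form at the indicators of single points need
    the lower estimate, which costs s_- each. The 2 comes from (|u| + |v|)^2 <= 2 (u^2 + v^2). The
    operator norm stands where a graph has its maximal degree: <P_k, L P_k> <= ||L|| rho(P_k) for a
    spectral projection P_k. Classical weights are available for each t, but no limit of them as t
    -> 0 is established; hence they have to disappear from the inequality before the limit is
    taken. *)

Section Adjoint.

(** * Adjoints, Hermitian spectra and the Lyapunov equation *)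

Variable C : numClosedFieldType.

Lemma adjmxE m n (A : 'M[C]_(m, n)) i j : A^t* i j = (A j i)^*.
Proof. by rewrite !mxE. Qed.

Lemma adjmxM m n p (A : 'M[C]_(m, n)) (B : 'M[C]_(n, p)) :
  (A *m B)^t* = B^t* *m A^t*.
Proof. by rewrite trmx_mul map_mxM. Qed.

Lemma adjmxB m n (A B : 'M[C]_(m, n)) : (A - B)^t* = A^t* - B^t*.
Proof. by apply/matrixP => i j; rewrite !mxE rmorphB. Qed.

Lemma adjmxD m n (A B : 'M[C]_(m, n)) : (A + B)^t* = A^t* + B^t*.
Proof. by apply/matrixP => i j; rewrite !mxE rmorphD. Qed.

Lemma adjmx1 n : (1%:M : 'M[C]_n)^t* = 1%:M.
Proof. by rewrite trmx1 map_mx1. Qed.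

Lemma adjmx_diag n (d : 'rV[C]_n) :
  (forall i, d 0 i \is Num.real) -> (diag_mx d)^t* = diag_mx d.
Proof.
move=> dr; apply/matrixP => i j; rewrite adjmxE !mxE eq_sym.
by case: eqP => [->|_]; rewrite ?mulr1n ?mulr0n ?conj0 // ?rmorph0 // conj_Creal.
Qed.

Lemma adjmx_scalar n (a : C) : (a%:M : 'M[C]_n)^t* = (a^*)%:M.
Proof.
by apply/matrixP => i j; rewrite adjmxE !mxE eq_sym; case: eqP; rewrite ?rmorph0.
Qed.

Lemma unitarymxK n (U : 'M[C]_n) : U \is unitarymx -> U *m U^t* = 1%:M.
Proof. by move/unitarymxP. Qed.

Lemma unitarymxKV n (U : 'M[C]_n) : U \is unitarymx -> U^t* *m U = 1%:M.
Proof. by move=> uU; rewrite -invmx_unitary // mulVmx // unitarymx_unit. Qed.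

Lemma hermitian_spectral n (A : 'M[C]_n) : A^t* = A ->
  A = (spectralmx A)^t* *m diag_mx (spectral_diag A) *m spectralmx A.
Proof.
move=> hA; have nA : A \is normalmx by apply/normalmxP; rewrite hA.
by rewrite -invmx_unitary ?spectral_unitarymx //; exact/orthomx_spectralP.
Qed.

Lemma hermitian_diag_real n (A : 'M[C]_n) i :
  A^t* = A -> spectral_diag A 0 i \is Num.real.
Proof.
move=> hA; have hA' : A \is hermsymmx.
  by apply/is_hermitianmxP; rewrite expr0 scale1r hA.
by have /mxOverP := hermitian_spectral_diag_real hA'; apply.
Qed.

Lemma mulmx_adj_entry m n p (A : 'M[C]_(n, m)) (Y : 'M[C]_n) (B : 'M[C]_(n, p)) k l :
  (A^t* *m Y *m B) k l = \sum_i \sum_j (A i k)^* * Y i j * B j l.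
Proof.
rewrite mxE exchange_big; apply: eq_bigr => j _.
by rewrite mxE mulr_suml; apply: eq_bigr => i _; rewrite adjmxE.
Qed.

(* Polarization: test vectors e_p + c e_q for c = 1 and c = 'i. *)
Lemma psd_hermitian N (G : 'M[C]_N) :
  (forall v : 'cV_N, (v^t* *m G *m v) 0 0 \is Num.real) -> G^t* = G.
Proof.
move=> Gr.
have gen p q (c : C) :
    G p p + c * G p q + c^* * G q p + c^* * c * G q q \is Num.real.
  have := Gr (delta_mx p 0 + c *: delta_mx q 0).
  congr (_ \is Num.real).
  have -> : (delta_mx p 0 + c *: delta_mx q 0 : 'cV[C]_N)^t* =
     delta_mx 0 p + c^* *: delta_mx 0 q.
    rewrite adjmxD; congr (_ + _); first by rewrite trmx_delta map_delta_mx.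
    by rewrite linearZ /= map_mxZ trmx_delta map_delta_mx.
  rewrite mulmxDl -scalemxAl -!rowE mulmxDr -scalemxAr -!colE !mxE.
  by ring.
have Grr p : G p p \is Num.real.
  have := gen p p 0; rewrite conjC0 !mul0r !addr0; exact.
apply/matrixP => p q; rewrite adjmxE.
have h1 := gen p q 1; have hi := gen p q 'i.
have mid x y z t : x \is @Num.real C -> t \is Num.real ->
    x + y + z + t \is Num.real -> y + z \is Num.real.
  move=> xr tr h; rewrite (_ : y + z = x + y + z + t - x - t); last by ring.
  by rewrite !rpredB.
rewrite conjC1 !mul1r in h1; rewrite conjCi !mulNr -expr2 sqrCi mulN1r opprK in hi.
move: {h1 hi}(mid _ _ _ _ (Grr p) (Grr q) h1) (mid _ _ _ _ (Grr p) (Grr q) hi) => h1 hi.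

have e1 : (G p q)^* + (G q p)^* = G p q + G q p.
  by rewrite -rmorphD; apply: conj_Creal.
have e2 : (G p q)^* - (G q p)^* = G q p - G p q.
  have /conj_Creal := hi; rewrite -mulrBr => h.
  move: h; rewrite rmorphM /= conjCi rmorphB /= => h.
  apply: (mulfI (neq0Ci C)); move: h; rewrite mulNr => /eqP.
  by rewrite eqr_oppLR -mulrN opprB => /eqP.
have : 2 * (G q p)^* = 2 * G p q.
  have -> : 2 * (G q p)^* = ((G p q)^* + (G q p)^*) - ((G p q)^* - (G q p)^*) by ring.
  by rewrite e1 e2; ring.
by apply: mulfI; rewrite pnatr_eq0.
Qed.

(* At a unit eigenvector v of M, with eigenvalue mu, the hypothesis reads
   0 <= 2 mu <v, diag(a) v>. *)
Lemma lyapunov_spectral N (M : 'M[C]_N) (a : 'I_N -> C) :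
  M^t* = M -> (forall p, 0 < a p) ->
  (forall v : 'I_N -> C,
     0 <= \sum_p \sum_q (v p)^* * (M p q * (a p + a q)) * v q) ->
  forall m, 0 <= spectral_diag M 0 m.
Proof.
move=> hM a_gt0 hp m.
set U := spectralmx M; set d := spectral_diag M.
have uU : U \is unitarymx by exact: spectral_unitarymx.
have MU : U *m M = diag_mx d *m U.
  by rewrite (hermitian_spectral hM) -/U -/d !mulmxA unitarymxK // mul1mx.
have rowM q : \sum_p U m p * M p q = d 0 m * U m q.
  by have /matrixP /(_ m q) := MU; rewrite mul_diag_mx !mxE.
have rd : d 0 m \is Num.real by apply: hermitian_diag_real.
have colM p : \sum_q M p q * (U m q)^* = d 0 m * (U m p)^*.
  rewrite -[d 0 m]conj_Creal // -rmorphM -rowM rmorph_sum; apply: eq_bigr => q _.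
  by rewrite rmorphM /= -(adjmxE M p q) hM mulrC.
have := hp (fun p => (U m p)^*).
have -> : \sum_p \sum_q (U m p)^*^* * (M p q * (a p + a q)) * (U m q)^* =
    d 0 m * (2 * \sum_p a p * `|U m p| ^+ 2).
  transitivity (\sum_p \sum_q (a p * U m p * (M p q * (U m q)^*) +
                   (U m p * M p q) * (a q * (U m q)^*))).
    by apply: eq_bigr => p _; apply: eq_bigr => q _; rewrite conjCK; ring.
  under eq_bigr do rewrite big_split /=.
  rewrite big_split /= [X in _ + X]exchange_big /=.
  rewrite (_ : \sum_p _ = \sum_p d 0 m * (a p * `|U m p| ^+ 2)); last first.
    by apply: eq_bigr => p _; rewrite -mulr_sumr colM normCK; ring.
  rewrite [X in _ + X](_ : _ = \sum_p d 0 m * (a p * `|U m p| ^+ 2)); last first.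
    by apply: eq_bigr => p _; rewrite -mulr_suml rowM normCK; ring.
  by rewrite -mulr_sumr; ring.
rewrite pmulr_lge0 // mulr_gt0 ?ltr0n //.
have nn p : 0 <= a p * `|U m p| ^+ 2 by rewrite mulr_ge0 ?exprn_ge0 // ltW.
rewrite lt_def sumr_ge0 // andbT psumr_eq0 //.
(* A vanishing sum would make row [m] of the unitary [U] zero. *)
apply/negP => /allP U0.
have : (U *m U^t*) m m = 0.
  rewrite mxE big1 // => p _.
  have := U0 p (mem_index_enum _); rewrite /= mulf_eq0 gt_eqF //=.
  by rewrite expf_eq0 /= normr_eq0 => /eqP ->; rewrite mul0r.
by rewrite unitarymxK // mxE eqxx => /eqP; rewrite oner_eq0.
Qed.

(** The hypothesis makes the entrywise product of [M] with a_p + a_q Hermitian, and dividing by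
    these real positive sums makes [M] Hermitian, so that the spectral argument applies. The factor
    is then the square root of the spectrum times the diagonalizing unitary. [T] will be a set of
    pairs of indices, while matrices want ordinals: hence the passage through [enum_val]. *)
Lemma lyapunov_factor (T : finType) (M : T -> T -> C) (a : T -> C) :
  (forall p, 0 < a p) ->
  (forall v : T -> C, 0 <= \sum_p \sum_q (v p)^* * (M p q * (a p + a q)) * v q) ->
  exists V : T -> T -> C, forall p q, M p q = \sum_m (V m p)^* * V m q.
Proof.
move=> a_gt0 hp.
pose G := \matrix_(i < #|T|, j < #|T|) M (enum_val i) (enum_val j).
pose b i : C := a (enum_val (i : 'I_#|T|)).
have sumE (F : T -> C) : \sum_p F p = \sum_(i < #|T|) F (enum_val i).
  by rewrite (reindex_onto enum_val enum_rank) /= => [|i _]; rewrite ?enum_rankK //;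
     apply: eq_bigl => i; rewrite enum_valK eqxx.
have hG v : 0 <= \sum_i \sum_j (v i)^* * (G i j * (b i + b j)) * v j.
  have := hp (v \o enum_rank); rewrite sumE.
  congr (0 <= _); apply: eq_bigr => i _; rewrite sumE; apply: eq_bigr => j _.
  by rewrite !mxE /= !enum_valK.
have b_gt0 i : 0 < b i by exact: a_gt0.
have Gh : G^t* = G.
  pose H := \matrix_(i, j) (G i j * (b i + b j)).
  have HE i j : H i j = G i j * (b i + b j) by rewrite mxE.
  have : H^t* = H.
    apply: psd_hermitian => v; apply: ger0_real.
    rewrite mulmx_adj_entry; have := hG (fun i => v i 0).
    by congr (0 <= _); apply: eq_bigr => i _; apply: eq_bigr => j _; rewrite HE.
  move=> /matrixP hH; apply/matrixP => i j.
  rewrite (adjmxE G); have := hH i j; rewrite (adjmxE H) !HE rmorphM rmorphD /=.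
  rewrite !(conj_Creal (gtr0_real (b_gt0 _))) addrC.
  by apply: mulIf; rewrite gt_eqF // addr_gt0.
have dge0 := lyapunov_spectral Gh b_gt0 hG.
pose U := spectralmx G.
exists (fun m p => sqrtC (spectral_diag G 0 (enum_rank m)) * U (enum_rank m) (enum_rank p)).
move=> p q; rewrite sumE.
transitivity (G (enum_rank p) (enum_rank q)); first by rewrite mxE !enum_rankK.
rewrite {1}(hermitian_spectral Gh) mxE; apply: eq_bigr => i _.
rewrite mul_mx_diag mxE adjmxE rmorphM /= !enum_valK -/U.
have sr : 0 <= sqrtC (spectral_diag G 0 i) by rewrite sqrtC_ge0.
rewrite (conj_Creal (ger0_real sr)) -{1}[spectral_diag G 0 i]sqrtCK.
by ring.
Qed.

End Adjoint.

(** * Commutator representation of the form of a KMS-symmetric map *)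

Section KmsForm.
Variable C : numClosedFieldType.

Definition kform n (S X Y : 'M[C]_n) : C := \tr (X^t* *m S *m Y *m S).

Lemma linear_entry n (F : {linear 'M[C]_n -> 'M[C]_n}) (Y : 'M[C]_n) k l :
  F Y k l = \sum_i \sum_j Y i j * F (delta_mx i j) k l.
Proof.
rewrite {1}[Y]matrix_sum_delta linear_sum summxE; apply: eq_bigr => i _.
rewrite linear_sum summxE; apply: eq_bigr => j _.
by rewrite linearZ mxE.
Qed.

(** Only cyclicity of the trace is used. The right-hand side is arranged so that every term has [V]
    and its adjoint on the two sides of one of [S], [S *m Y], [Y *m S]: summed over a family of [V],
    it involves only the completely positive maps that the family defines. *)
Lemma kform_commutator n (S V X Y : 'M[C]_n) :
  kform S (V *m X - X *m V) (V *m Y - Y *m V) =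
  \tr (X^t* *m (V^t* *m S *m V) *m Y *m S) +
  \tr (X^t* *m S *m Y *m (V *m S *m V^t*)) -
  (\tr (X^t* *m (V^t* *m (S *m Y) *m V *m S)) +
   \tr (X^t* *m (S *m (V *m (Y *m S) *m V^t*)))).
Proof.
rewrite /kform adjmxB !adjmxM.
move: (X^t*) (V^t*) => A B; rewrite !mulmxBl !mulmxBr !mulmxBl !raddfB /= !mulmxA.
have cyc Z : \tr (B *m Z) = \tr (Z *m B) by rewrite mxtrace_mulC.
have -> : \tr (B *m A *m S *m V *m Y *m S) = \tr (A *m S *m V *m Y *m S *m B).
  by rewrite -cyc !mulmxA.
have -> : \tr (B *m A *m S *m Y *m V *m S) = \tr (A *m S *m Y *m V *m S *m B).
  by rewrite -cyc !mulmxA.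
by ring.
Qed.

Lemma kform_linearr n (S X Y Z : 'M[C]_n) a :
  kform S X (a *: Y + Z) = a * kform S X Y + kform S X Z.
Proof.
by rewrite /kform mulmxDr mulmxDl -scalemxAr -scalemxAl linearD linearZ.
Qed.

Lemma kformC n (S X Y : 'M[C]_n) : S^t* = S -> kform S Y X = (kform S X Y)^*.
Proof.
move=> hS; have trC (A : 'M[C]_n) : (\tr A)^* = \tr (A^t*).
  by rewrite rmorph_sum; apply: eq_bigr => i _; rewrite adjmxE.
by rewrite /kform trC !adjmxM trmxCK hS !mulmxA mxtrace_mulC !mulmxA.
Qed.

(** The hypothesis on [v] is positivity of the Choi matrix of [F], indexed by pairs (input index,
    output index). The three other properties of [F] serve different ends: linearity determines it
    from the Choi matrix, symmetry makes the family [V] interchangeable with its adjoints, unitality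
    fixes the term in which [F] is absent. *)
Lemma commutator_form_diag n (s : 'rV[C]_n) (F : {linear 'M[C]_n -> 'M[C]_n}) :
    (forall i, 0 < s 0 i) ->
    (forall v : 'I_n * 'I_n -> C, 0 <= \sum_p \sum_q
       (v p)^* * F (delta_mx p.1 q.1) p.2 q.2 * v q) ->
    F 1%:M = 1%:M ->
    (forall X Y, kform (diag_mx s) X (F Y) = kform (diag_mx s) (F X) Y) ->
  exists V : 'I_n * 'I_n -> 'M[C]_n, forall X Y,
    kform (diag_mx s) X Y - kform (diag_mx s) X (F Y) =
    \sum_m kform (diag_mx s) (V m *m X - X *m V m) (V m *m Y - Y *m V m).
Proof.
move=> s_gt0 hcp F1 hsym; set S := diag_mx s.
have s_real i : s 0 i \is Num.real by rewrite gtr0_real.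
have s_neq0 i : s 0 i != 0 by rewrite gt_eqF.
have hS : S^t* = S by apply: adjmx_diag.
have den_neq0 i j k l : s 0 i * s 0 l + s 0 j * s 0 k != 0.
  by rewrite gt_eqF // addr_gt0 // mulr_gt0.
(* M is to be the Gram matrix sum_m conj(V_m p) V_m q; its formula is forced by
   S F(Y) S = sum_m (V_m^* S Y V_m S + S V_m^* Y S V_m). *)
pose M (p q : 'I_n * 'I_n) := s 0 p.2 * s 0 q.2 * F (delta_mx p.1 q.1) p.2 q.2
   / (s 0 p.1 * s 0 q.2 + s 0 q.1 * s 0 p.2).
have FM i j k l : s 0 k * s 0 l * F (delta_mx i j) k l =
   M (i, k) (j, l) * (s 0 i * s 0 l + s 0 j * s 0 k).
  by rewrite /M /= divfK.
(* The sum of s_(p.1) / s_(p.2) and s_(q.1) / s_(q.2) is the denominator of [M p q] divided by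
   s_(p.2) s_(q.2), so multiplying [M] by it gives back the Choi matrix. *)
have [p|v|V hV] := @lyapunov_factor C _ M (fun p => s 0 p.1 / s 0 p.2).
- by rewrite divr_gt0.
- have := hcp v; congr (0 <= _); apply: eq_bigr => p _; apply: eq_bigr => q _.
  congr (_ * _ * _); rewrite /M; field.
  by rewrite den_neq0 !s_neq0.
(* Symmetry tested on matrix units. It says that the adjoints of the V_m have the same Gram matrix
   as the V_m, which is why [PE] and [PE'] below give the same map [P]. *)
have MC i j k l : M (i, k) (j, l) = (M (k, i) (l, j))^*.
  have kE X Y : kform S X Y = \sum_i \sum_j (X i j)^* * s 0 i * Y i j * s 0 j.
    rewrite /kform /mxtrace exchange_big /=; apply: eq_bigr => b _.
    rewrite mul_mx_diag mxE -mulmxA mxE mulr_suml; apply: eq_bigr => c _.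
    by rewrite adjmxE mul_diag_mx !mxE mulrA.
  have dE a b (f : 'I_n -> 'I_n -> C) :
      \sum_i \sum_j ((delta_mx a b : 'M[C]_n) i j) * f i j = f a b.
    rewrite (bigD1 a) //= [X in _ + X]big1 ?addr0 => [|x xa]; last first.
      by rewrite big1 // => y _; rewrite mxE (negPf xa) mul0r.
    rewrite (bigD1 b) //= big1 ?addr0 => [|y yb]; first by rewrite mxE !eqxx mul1r.
    by rewrite mxE (negPf yb) andbF mul0r.
  have := hsym (delta_mx k l) (delta_mx i j); rewrite !kE.
  have cE a b x y : ((delta_mx a b : 'M[C]_n) x y)^* = (delta_mx a b : 'M[C]_n) x y.
    by rewrite mxE; case: (_ && _); rewrite ?conjC1 ?conjC0.
  move=> e.
  have {e} : s 0 k * F (delta_mx i j) k l * s 0 l =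
      s 0 i * (F (delta_mx k l) i j)^* * s 0 j.
    rewrite -(dE k l (fun x y => s 0 x * F (delta_mx i j) x y * s 0 y)).
    rewrite -(dE i j (fun x y => s 0 x * (F (delta_mx k l) x y)^* * s 0 y)).
    rewrite [RHS](_ : _ = \sum_x \sum_y (F (delta_mx k l) x y)^* * s 0 x *
              (delta_mx i j : 'M[C]_n) x y * s 0 y); last first.
      by apply: eq_bigr => x _; apply: eq_bigr => y _; ring.
    rewrite -e; apply: eq_bigr => x _; apply: eq_bigr => y _; rewrite cE; ring.
  rewrite mulrAC /M /= => ->; rewrite rmorphM fmorphV rmorphD !rmorphM /=.
  rewrite !(conj_Creal (s_real _)).
  by congr (_ / _); ring.
pose W m : 'M[C]_n := \matrix_(i, j) V m (i, j).
pose P (A : 'M[C]_n) : 'M[C]_n :=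
  \matrix_(k, l) \sum_i \sum_j M (i, k) (j, l) * A i j.
have PE A : \sum_m (W m)^t* *m A *m W m = P A.
  apply/matrixP => k l; rewrite summxE mxE.
  under eq_bigr do rewrite mulmx_adj_entry.
  rewrite exchange_big; apply: eq_bigr => i _.
  rewrite exchange_big; apply: eq_bigr => j _.
  by rewrite hV mulr_suml; apply: eq_bigr => m _; rewrite !mxE; ring.
have PE' A : \sum_m W m *m A *m (W m)^t* = P A.
  apply/matrixP => k l; rewrite summxE mxE.
  transitivity (\sum_m \sum_i \sum_j W m k i * A i j * (W m l j)^*).
    apply: eq_bigr => m _; rewrite mxE exchange_big; apply: eq_bigr => j _.
    by rewrite mxE mulr_suml; apply: eq_bigr => i _; rewrite adjmxE.
  rewrite exchange_big; apply: eq_bigr => i _.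
  rewrite exchange_big; apply: eq_bigr => j _.
  rewrite MC hV rmorph_sum mulr_suml; apply: eq_bigr => m _.
  by rewrite !mxE rmorphM /= conjCK; ring.
have SE A k l : (S *m A) k l = s 0 k * A k l by rewrite mul_diag_mx mxE.
have ES A k l : (A *m S) k l = A k l * s 0 l by rewrite mul_mx_diag mxE.
have addE (A B : 'M[C]_n) k l : (A + B) k l = A k l + B k l by rewrite mxE.
have PEij A k l : P A k l = \sum_i \sum_j M (i, k) (j, l) * A i j by rewrite mxE.
have SFS Y : S *m F Y *m S = P (S *m Y) *m S + S *m P (Y *m S).
  apply/matrixP => k l; rewrite addE !ES !SE !PEij linear_entry.
  rewrite mulr_sumr !mulr_suml mulr_sumr -big_split; apply: eq_bigr => i _ /=.
  rewrite mulr_sumr !mulr_suml mulr_sumr -big_split; apply: eq_bigr => j _ /=.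
  rewrite ES SE.
  transitivity (Y i j * (s 0 k * s 0 l * F (delta_mx i j) k l)); first by ring.
  by rewrite FM; ring.
(* At Y = 1 the identity [SFS] becomes the Sylvester equation P(S) S + S P(S) = S^2, whose solution
   is unique because s_k + s_l > 0. *)
have PS : P S = 2^-1 *: S.
  have := SFS 1%:M; rewrite F1 mulmx1 mul1mx => /matrixP h.
  apply/matrixP => k l; have := h k l.
  rewrite addE !ES !SE [X in _ -> _ = X]mxE => e.
  have /mulfI : s 0 k + s 0 l != 0 by rewrite gt_eqF // addr_gt0.
  apply; rewrite mulrDl [s 0 l * _]mulrC addrC -e [S k l]mxE.
  by case: eqP => [->|_]; rewrite ?mulr1n ?mulr0n; field.
exists W => X Y.
pose tX := X^t*.
(* By [PS], each of the first two traces is half of <X, Y>; split in this way the expression matches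
   [kform_commutator]. *)
transitivity (\tr (tX *m P S *m Y *m S) + \tr (tX *m S *m Y *m P S)
   - \tr (tX *m (S *m F Y *m S))).
  rewrite PS -!scalemxAr -!scalemxAl !linearZ /= -/(kform _ _ _) -mulrDl.
  rewrite (_ : 2^-1 + 2^-1 = 1 :> C); last by field.
  by rewrite mul1r /kform !mulmxA.
rewrite SFS mulmxDr linearD /=.
have -> : \tr (tX *m P S *m Y *m S) =
    \sum_m \tr (tX *m ((W m)^t* *m S *m W m) *m Y *m S).
  by rewrite -PE mulmx_sumr !mulmx_suml linear_sum.
have -> : \tr (tX *m S *m Y *m P S) =
    \sum_m \tr (tX *m S *m Y *m (W m *m S *m (W m)^t*)).
  by rewrite -PE' mulmx_sumr linear_sum.
have -> : \tr (tX *m (P (S *m Y) *m S)) =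
    \sum_m \tr (tX *m ((W m)^t* *m (S *m Y) *m W m *m S)).
  by rewrite -PE mulmx_suml mulmx_sumr linear_sum.
have -> : \tr (tX *m (S *m P (Y *m S))) =
    \sum_m \tr (tX *m (S *m (W m *m (Y *m S) *m (W m)^t*))).
  by rewrite -PE' !mulmx_sumr linear_sum.
rewrite -!big_split -sumrB; apply: eq_bigr => m _ /=.
by rewrite kform_commutator.
Qed.

Lemma kform_conj n (U S X Y : 'M[C]_n) : U \is unitarymx ->
  kform (U^t* *m S *m U) X Y =
  kform S (U *m X *m U^t*) (U *m Y *m U^t*).
Proof.
by move=> uU; rewrite /kform !adjmxM trmxCK !mulmxA mxtrace_mulC !mulmxA.
Qed.

(** Conjugation by [U] reduces to diagonal [S]. Positivity is required only on blocks E_i E_j^*,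
    since the matrix units, moved back by [U], have this form with E_i = U^* e_i. *)
Lemma commutator_form n (S U : 'M[C]_n) (s : 'rV[C]_n)
    (F : {linear 'M[C]_n -> 'M[C]_n}) :
    U \is unitarymx -> S = U^t* *m diag_mx s *m U -> (forall i, 0 < s 0 i) ->
    (forall E v : 'I_n -> 'cV[C]_n, 0 <= \sum_i \sum_j
       ((v i)^t* *m F (E i *m (E j)^t*) *m v j) 0 0) ->
    F 1%:M = 1%:M ->
    (forall X Y, kform S X (F Y) = kform S (F X) Y) ->
  exists V : 'I_n * 'I_n -> 'M[C]_n, forall X Y,
    kform S X Y - kform S X (F Y) =
    \sum_m kform S (V m *m X - X *m V m) (V m *m Y - Y *m V m).
Proof.
move=> uU SE s_gt0 hcp F1 hsym.
have UU := unitarymxK uU; have UU' := unitarymxKV uU.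
pose G : {linear 'M[C]_n -> 'M[C]_n} :=
  (mulmxr (U^t*) \o (mulmx U \o (F \o (mulmxr U \o mulmx (U^t*)))))%FUN.
have GE Y : G Y = U *m F (U^t* *m Y *m U) *m U^t* by [].
have [v||X Y|V hV] := @commutator_form_diag n s G s_gt0.
- have := hcp (fun i => U^t* *m delta_mx i 0) (fun i => U^t* *m \col_k v (i, k)).
  congr (0 <= _).
  have pE (g : 'I_n * 'I_n -> C) : \sum_p g p = \sum_i \sum_k g (i, k).
    by rewrite pair_bigA; apply: eq_bigr => -[].
  rewrite pE; apply: eq_bigr => i _.
  under [RHS]eq_bigr do rewrite pE /=.
  rewrite [RHS]exchange_big; apply: eq_bigr => j _ /=.
  have -> : U^t* *m delta_mx i 0 *m (U^t* *m delta_mx j 0 : 'cV[C]_n)^t* =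
            U^t* *m delta_mx i j *m U.
    rewrite adjmxM trmxCK trmx_delta map_delta_mx !mulmxA; congr (_ *m _).
    by rewrite -!mulmxA mul_delta_mx.
  transitivity (((\col_k v (i, k))^t* *m G (delta_mx i j) *m \col_l v (j, l)) 0 0).
    by rewrite GE !adjmxM trmxCK !mulmxA.
  rewrite mulmx_adj_entry; apply: eq_bigr => k _; apply: eq_bigr => l _.
  by rewrite !mxE.
- by rewrite GE mulmx1 UU' F1 mulmx1 UU.
- have inv Z : Z = U *m (U^t* *m Z *m U) *m U^t*.
    by rewrite !mulmxA UU mul1mx -mulmxA UU mulmx1.
  have := hsym (U^t* *m X *m U) (U^t* *m Y *m U).
  by rewrite SE !kform_conj // -!inv -!GE.
exists (fun m => U^t* *m V m *m U) => X Y.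
rewrite SE !kform_conj //.
have -> : U *m F Y *m U^t* = G (U *m Y *m U^t*).
  by rewrite GE !mulmxA UU' mul1mx -(mulmxA Y) UU' mulmx1.
rewrite hV; apply: eq_bigr => m _.
rewrite kform_conj //.
have com Z : V m *m (U *m Z *m U^t*) - U *m Z *m U^t* *m V m =
    U *m (U^t* *m V m *m U *m Z - Z *m (U^t* *m V m *m U)) *m U^t*.
  rewrite mulmxBr mulmxBl !mulmxA UU mul1mx; congr (_ - _).
  by rewrite -[RHS]mulmxA UU mulmx1.
by rewrite !com.
Qed.

Lemma kform_diagE n (s : 'rV[C]_n) (Z : 'M[C]_n) : (forall i, 0 <= s 0 i) ->
  kform (diag_mx s) Z Z = \sum_i \sum_j s 0 i * s 0 j * `|Z i j| ^+ 2.
Proof.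
move=> s_ge0; rewrite /kform /mxtrace exchange_big /=; apply: eq_bigr => b _.
rewrite mul_mx_diag mxE -mulmxA mxE mulr_suml; apply: eq_bigr => c _.
by rewrite adjmxE mul_diag_mx !mxE normCK; ring.
Qed.

Lemma hsE n (Z : 'M[C]_n) : \tr (Z^t* *m Z) = \sum_i \sum_j `|Z i j| ^+ 2.
Proof.
rewrite /mxtrace exchange_big; apply: eq_bigr => j _; rewrite mxE.
by apply: eq_bigr => i _; rewrite adjmxE normCK mulrC.
Qed.

Lemma hs_conj n (U Z : 'M[C]_n) : U \is unitarymx ->
  \tr ((U *m Z *m U^t*)^t* *m (U *m Z *m U^t*)) = \tr (Z^t* *m Z).
Proof.
move=> uU; rewrite !adjmxM trmxCK !mulmxA mxtrace_mulC !mulmxA (unitarymxKV uU).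
by rewrite mul1mx -(mulmxA _ (U^t*) U) (unitarymxKV uU) mulmx1.
Qed.

Lemma kform_hs n (S U : 'M[C]_n) (s : 'rV[C]_n) (a b : C) (Z : 'M[C]_n) :
    U \is unitarymx -> S = U^t* *m diag_mx s *m U -> (forall i, 0 <= s 0 i) ->
    (forall i j, a <= s 0 i * s 0 j <= b) ->
  a * \tr (Z^t* *m Z) <= kform S Z Z <= b * \tr (Z^t* *m Z).
Proof.
move=> uU -> s_ge0 hab; rewrite kform_conj // kform_diagE // -(hs_conj Z uU) hsE.
rewrite !mulr_sumr; apply/andP; split; apply: ler_sum => i _;
  rewrite mulr_sumr; apply: ler_sum => j _; rewrite ler_wpM2r ?exprn_ge0 //;
  by case/andP: (hab i j).
Qed.

Lemma hs_commutator n (W V X : 'M[C]_n) (f : 'rV[C]_n) :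
  W \is unitarymx -> X = W^t* *m diag_mx f *m W ->
  \tr ((V *m X - X *m V)^t* *m (V *m X - X *m V)) =
  \sum_k \sum_l `|(W *m V *m W^t*) k l| ^+ 2 * `|f 0 k - f 0 l| ^+ 2.
Proof.
move=> uW XE; rewrite -(hs_conj _ uW) hsE.
apply: eq_bigr => k _; apply: eq_bigr => l _.
have WW := unitarymxK uW.
rewrite [`|f 0 k - _|]distrC -exprMn -normrM; congr (_ ^+ 2).
have -> : W *m (V *m X - X *m V) *m W^t* =
    W *m V *m W^t* *m diag_mx f - diag_mx f *m (W *m V *m W^t*).
  rewrite XE mulmxBr mulmxBl !mulmxA WW mul1mx; congr (_ - _).
  by rewrite -[LHS]mulmxA WW mulmx1.
rewrite mul_mx_diag mul_diag_mx; move: (W *m V *m W^t*) => A; rewrite !mxE.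
by congr (`|_|); ring.
Qed.

(** The order of quantifiers is the point: [w] depends on [F] and on the basis [W] but not on [f],
    so the form can be compared at a function, at its level sets and at single points. *)
Lemma form_sandwich n (S U : 'M[C]_n) (s : 'rV[C]_n) (a b : C)
    (F : {linear 'M[C]_n -> 'M[C]_n}) (W : 'M[C]_n) :
    U \is unitarymx -> S = U^t* *m diag_mx s *m U -> (forall i, 0 < s 0 i) ->
    (forall i j, a <= s 0 i * s 0 j <= b) ->
    (forall E v : 'I_n -> 'cV[C]_n, 0 <= \sum_i \sum_j
       ((v i)^t* *m F (E i *m (E j)^t*) *m v j) 0 0) ->
    F 1%:M = 1%:M ->
    (forall X Y, kform S X (F Y) = kform S (F X) Y) ->
    W \is unitarymx ->
  exists w : 'I_n -> 'I_n -> C, (forall k l, 0 <= w k l) /\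
    forall (f : 'rV[C]_n) X, X = W^t* *m diag_mx f *m W ->
    a * (\sum_k \sum_l w k l * `|f 0 k - f 0 l| ^+ 2)
      <= kform S X X - kform S X (F X)
      <= b * (\sum_k \sum_l w k l * `|f 0 k - f 0 l| ^+ 2).
Proof.
move=> uU SE s_gt0 hab hcp F1 hsym uW.
have [V hV] := commutator_form uU SE s_gt0 hcp F1 hsym.
exists (fun k l => \sum_m `|(W *m V m *m W^t*) k l| ^+ 2).
split=> [k l|f].
  by apply: sumr_ge0 => m _; rewrite exprn_ge0.
move=> X XE; have -> : \sum_k \sum_l (\sum_m `|(W *m V m *m W^t*) k l| ^+ 2) * `|f 0 k - f 0 l| ^+ 2
   = \sum_m \tr ((V m *m X - X *m V m)^t* *m (V m *m X - X *m V m)).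
  rewrite (eq_bigr _ (fun m _ => hs_commutator (V m) uW XE)).
  rewrite [RHS]exchange_big; apply: eq_bigr => k _.
  rewrite [RHS]exchange_big; apply: eq_bigr => l _.
  by rewrite mulr_suml.
rewrite hV !mulr_sumr; have h m := kform_hs (V m *m X - X *m V m) uU SE
  (fun i => ltW (s_gt0 i)) hab.
by apply/andP; split; apply: ler_sum => m _; case/andP: (h m).
Qed.

End KmsForm.

(** * The square root of a density matrix, and functional calculus *)

Section PosDef.
Variable C : numClosedFieldType.

Section PositiveDefinite.
Variables (n : nat) (D : 'M[C]_n).
Hypothesis hD : forall v : 'cV[C]_n, v != 0 -> 0 < (v^t* *m D *m v) 0 0.

Lemma posdef_hermitian : D^t* = D.
Proof.
apply: psd_hermitian => v; apply: ger0_real.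
have [->|v0] := eqVneq v 0; first by rewrite mulmx0 mxE.
exact/ltW/hD.
Qed.

Lemma posdef_spectral_gt0 i : 0 < spectral_diag D 0 i.
Proof.
have uU := spectral_unitarymx D; set U := spectralmx D in uU.
have v0 : U^t* *m (delta_mx i 0 : 'cV[C]_n) != 0.
  apply/eqP => /(congr1 (mulmx U)); rewrite mulmxA (unitarymxK uU) mul1mx mulmx0.
  by move=> /matrixP/(_ i 0); rewrite !mxE !eqxx => /eqP; rewrite oner_eq0.
have := hD v0; rewrite {1}(hermitian_spectral posdef_hermitian) -/U adjmxM trmxCK.
rewrite !mulmxA -(mulmxA _ U (U^t*)) (unitarymxK uU) mulmx1.
rewrite -(mulmxA _ U (U^t*)) (unitarymxK uU) mulmx1 trmx_delta map_delta_mx.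
by rewrite -mulmxA -rowE -colE !mxE eqxx mulr1n.
Qed.

Definition sv : 'rV[C]_n := map_mx sqrtC (spectral_diag D).

Lemma sv_gt0 i : 0 < sv 0 i.
Proof. by rewrite mxE sqrtC_gt0 posdef_spectral_gt0. Qed.

Lemma sv_sqr i : sv 0 i ^+ 2 = spectral_diag D 0 i.
Proof. by rewrite mxE sqrtCK. Qed.

(* [sqrtmx D] of Defs over a general numClosedFieldType; for C = R[i] the two are
   convertible. *)
Definition psqrtmx := invmx (spectralmx D) *m diag_mx sv *m spectralmx D.

Lemma psqrtmxE : psqrtmx = (spectralmx D)^t* *m diag_mx sv *m spectralmx D.
Proof. by rewrite /psqrtmx invmx_unitary ?spectral_unitarymx. Qed.

Lemma psqrtmx_sqr : psqrtmx *m psqrtmx = D.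
Proof.
have uU := spectral_unitarymx D.
rewrite psqrtmxE [RHS](hermitian_spectral posdef_hermitian).
set U := spectralmx D in uU *.
rewrite !mulmxA -(mulmxA (U^t* *m _) U (U^t*)) (unitarymxK uU) mulmx1; congr (_ *m _).
rewrite -mulmxA; congr (_ *m _); apply/matrixP => i j.
rewrite mul_diag_mx mxE [X in _ * X]mxE [RHS]mxE -sv_sqr.
by case: eqP => [->|_]; rewrite ?mulr1n ?mulr0n ?mulr0 // expr2.
Qed.

Lemma eigenvalue_spectral s : eigenvalue D s <-> exists i, spectral_diag D 0 i = s.
Proof.
have uU := spectral_unitarymx D; set U := spectralmx D in uU.
have DE : D = U^t* *m diag_mx (spectral_diag D) *m U.
  exact: hermitian_spectral posdef_hermitian.
split=> [/eigenvalueP[v vD v0]|[i <-]].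
  have : v *m U^t* *m diag_mx (spectral_diag D) = s *: (v *m U^t*).
    move/(congr1 (mulmx^~ (U^t*))): vD; rewrite {1}DE !mulmxA -(mulmxA _ U) (unitarymxK uU).
    by rewrite mulmx1 -scalemxAl.
  set w := v *m U^t* => we.
  have /rV0Pn[i wi] : w != 0.
    apply: contra v0 => /eqP w0; rewrite -(mulmx1 v) -(unitarymxKV uU) mulmxA -/w w0.
    by rewrite mul0mx.
  exists i; clearbody w; have /matrixP/(_ 0 i) := we; rewrite mul_mx_diag !mxE mulrC.
  by move/(mulIf wi).
apply/eigenvalueP; exists (row i U).
  have UD : U *m D = diag_mx (spectral_diag D) *m U.
    by rewrite {1}DE !mulmxA (unitarymxK uU) mul1mx.
  rewrite -row_mul UD; apply/rowP => j.
  by rewrite mul_diag_mx !mxE.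
apply/eqP => r0; have := unitarymxK uU => /matrixP/(_ i i).
rewrite !mxE eqxx big1 => [/esym/eqP|k _]; first by rewrite oner_eq0.
by have /rowP/(_ k) := r0; rewrite !mxE => ->; rewrite mul0r.
Qed.


(** As P = P^* P, the trace is the sum of the quadratic form of [D] over the columns of [P], one of
    which is nonzero. *)
Lemma state_proj_gt0 (P : 'M[C]_n) :
  P^t* = P -> P *m P = P -> P != 0 -> 0 < \tr (D *m P).
Proof.
move=> Ph PP P0.
have -> : \tr (D *m P) = \sum_j ((col j P)^t* *m D *m col j P) 0 0.
  rewrite -{1}PP mulmxA mxtrace_mulC mulmxA -{1}Ph /mxtrace.
  apply: eq_bigr => j _; rewrite -[LHS]/((P^t* *m D *m P) j j).
  rewrite !mulmx_adj_entry; apply: eq_bigr => i _; apply: eq_bigr => k _.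
  by rewrite !mxE.
have nn j : 0 <= ((col j P)^t* *m D *m col j P) 0 0.
  have [->|c0] := eqVneq (col j P) 0; first by rewrite mulmx0 mxE.
  exact/ltW/hD.
rewrite lt_def sumr_ge0 ?andbT // psumr_eq0 //.
apply: contra P0 => /allP z; apply/eqP/matrixP => i j.
have [c0|/hD] := eqVneq (col j P) 0.
  by have /colP/(_ i) := c0; rewrite !mxE.
by rewrite (eqP (z j (mem_index_enum _))) ltxx.
Qed.

Lemma posdef_conj_gt0 (W : 'M[C]_n) k :
  W \is unitarymx -> 0 < (W *m D *m W^t*) k k.
Proof.
move=> uW; have v0 : W^t* *m (delta_mx k 0 : 'cV[C]_n) != 0.
  apply/eqP => /(congr1 (mulmx W)); rewrite mulmxA (unitarymxK uW) mul1mx mulmx0.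
  by move=> /matrixP/(_ k 0); rewrite !mxE !eqxx => /eqP; rewrite oner_eq0.
have := hD v0; rewrite adjmxM trmxCK trmx_delta map_delta_mx !mulmxA -colE.
by rewrite -!mulmxA -rowE !mulmxA !mxE.
Qed.

Lemma psqrtmx_hermitian : psqrtmx^t* = psqrtmx.
Proof.
rewrite psqrtmxE !adjmxM trmxCK adjmx_diag ?mulmxA // => i.
by rewrite gtr0_real ?sv_gt0.
Qed.

Lemma kform1X (X : 'M[C]_n) : kform psqrtmx 1%:M X = \tr (D *m X).
Proof.
by rewrite /kform adjmx1 mul1mx mxtrace_mulC mulmxA psqrtmx_sqr.
Qed.

(** The moduli |Y_ij| are symmetric in i and j, so the trace can be symmetrized. The coefficients
    s_i^2 + s_j^2 then face the s_i s_j of [kform_psqrtE], and the two quadratic forms can be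
    compared term by term. *)
Lemma trace_sqrE (X : 'M[C]_n) : X^t* = X ->
  let Y := spectralmx D *m X *m (spectralmx D)^t* in
  \tr (D *m (X *m X)) *+ 2 =
  \sum_i \sum_j (sv 0 i ^+ 2 + sv 0 j ^+ 2) * `|Y i j| ^+ 2.
Proof.
move=> hX /=; have uU := spectral_unitarymx D; set U := spectralmx D in uU *.
set Y := U *m X *m U^t*.
have Yh : Y^t* = Y by rewrite !adjmxM trmxCK hX mulmxA.
have YE i j : `|Y j i| = `|Y i j| by rewrite -{1}Yh adjmxE norm_conjC.
have XX : \tr (D *m (X *m X)) = \sum_i \sum_j sv 0 i ^+ 2 * `|Y i j| ^+ 2.
  have -> : \tr (D *m (X *m X)) = \tr (diag_mx (spectral_diag D) *m (Y *m Y^t*)).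
    rewrite {1}(hermitian_spectral posdef_hermitian) -/U Yh /Y -!mulmxA mxtrace_mulC.
    by rewrite !mulmxA -(mulmxA _ (U^t*) U) (unitarymxKV uU) mulmx1.
  apply: eq_bigr => i _; rewrite mul_diag_mx mxE sv_sqr mxE mulr_sumr.
  by apply: eq_bigr => j _; rewrite adjmxE normCK.
rewrite mulr2n {2}XX XX [X in _ + X]exchange_big -big_split; apply: eq_bigr => i _.
rewrite -big_split; apply: eq_bigr => j _ /=; rewrite YE; ring.
Qed.

Lemma kform_psqrtE (X : 'M[C]_n) :
  let Y := spectralmx D *m X *m (spectralmx D)^t* in
  kform psqrtmx X X = \sum_i \sum_j sv 0 i * sv 0 j * `|Y i j| ^+ 2.
Proof.
rewrite /= psqrtmxE kform_conj ?spectral_unitarymx // kform_diagE // => i.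
exact/ltW/sv_gt0.
Qed.

Lemma trace_sqr_le (X : 'M[C]_n) (c : C) : X^t* = X ->
  (forall i j, sv 0 i ^+ 2 + sv 0 j ^+ 2 <= c * (sv 0 i * sv 0 j)) ->
  \tr (D *m (X *m X)) *+ 2 <= c * kform psqrtmx X X.
Proof.
move=> hX hc; rewrite trace_sqrE // kform_psqrtE mulr_sumr.
apply: ler_sum => i _; rewrite mulr_sumr; apply: ler_sum => j _.
by rewrite mulrA ler_wpM2r ?exprn_ge0.
Qed.

(** The inequality 2 s_i s_j <= s_i^2 + s_j^2 termwise. It serves twice: for a projection it gives
    ||P||^2 <= rho(P), and for a function of X it bounds the KMS norm by a classical second
    moment. *)
Lemma kform_le_trace_sqr (X : 'M[C]_n) : X^t* = X ->
  kform psqrtmx X X <= \tr (D *m (X *m X)).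
Proof.
move=> hX; rewrite -(ler_pMn2r (ltn0Sn 1)) trace_sqrE // kform_psqrtE -mulr_natl.
rewrite mulr_sumr; apply: ler_sum => i _; rewrite mulr_sumr; apply: ler_sum => j _.
rewrite mulrA ler_wpM2r ?exprn_ge0 // -subr_ge0.
have r i' : sv 0 i' \is Num.real by rewrite gtr0_real ?sv_gt0.
have -> : sv 0 i ^+ 2 + sv 0 j ^+ 2 - 2 * (sv 0 i * sv 0 j) = (sv 0 i - sv 0 j) ^+ 2.
  by ring.
by rewrite real_exprn_even_ge0 // rpredB.
Qed.

End PositiveDefinite.

Section FunctionalCalculus.
Variables (n : nat) (W : 'M[C]_n).
Hypothesis uW : W \is unitarymx.

(** The basis [W] stays fixed while [f] varies: X, its shifts, its level projections and its
    spectral projections all lie in this commutative algebra. *)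
Definition fcalc (f : 'I_n -> C) := W^t* *m diag_mx (\row_k f k) *m W.

Lemma fcalc_hermitian f : (forall k, f k \is Num.real) -> (fcalc f)^t* = fcalc f.
Proof.
move=> fr; rewrite /fcalc !adjmxM trmxCK adjmx_diag ?mulmxA // => i.
by rewrite mxE.
Qed.

Lemma fcalcM f g : fcalc f *m fcalc g = fcalc (fun k => f k * g k).
Proof.
rewrite /fcalc !mulmxA -(mulmxA _ W (W^t*)) (unitarymxK uW) mulmx1.
congr (_ *m _); rewrite -mulmxA; congr (_ *m _); apply/matrixP => i j.
by rewrite mul_diag_mx !mxE; case: eqP => [->|_]; rewrite ?mulr1n // !mulr0n mulr0.
Qed.

Lemma fcalc_cst c : fcalc (fun=> c) = c%:M.
Proof.
rewrite /fcalc (_ : diag_mx _ = c%:M); last first.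
  by apply/matrixP => i j; rewrite !mxE.
by rewrite mul_mx_scalar -scalemxAl unitarymxKV // scalemx1.
Qed.

Lemma fcalcB f g h : (forall k, h k = f k - g k) -> fcalc h = fcalc f - fcalc g.
Proof.
move=> hE; rewrite /fcalc -mulmxBl -mulmxBr -raddfB; congr (_ *m diag_mx _ *m _).
by apply/rowP => k; rewrite !mxE.
Qed.

Lemma trace_fcalc D f : \tr (D *m fcalc f) = \sum_k (W *m D *m W^t*) k k * f k.
Proof.
rewrite /fcalc mulmxA mxtrace_mulC !mulmxA mul_mx_diag.
by apply: eq_bigr => k _; rewrite !mxE.
Qed.

End FunctionalCalculus.
End PosDef.

(** * The classical Cheeger inequality on a finite set *)

Section Coarea.
Variable R : realFieldType.

(** Lagrange's identity: the difference of the two sides is half a weighted sum of squares. *)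
Lemma weighted_cauchy_schwarz (I : finType) (w a b : I -> R) :
  (forall i, 0 <= w i) ->
  (\sum_i w i * (a i * b i)) ^+ 2 <=
  (\sum_i w i * a i ^+ 2) * (\sum_i w i * b i ^+ 2).
Proof.
move=> w0.
have h : 0 <= \sum_i \sum_j w i * w j * (a i * b j - a j * b i) ^+ 2.
  by apply: sumr_ge0 => i _; apply: sumr_ge0 => j _; rewrite mulr_ge0 ?sqr_ge0 // mulr_ge0.
suff : \sum_i \sum_j w i * w j * (a i * b j - a j * b i) ^+ 2 =
   2 * ((\sum_i w i * a i ^+ 2) * (\sum_i w i * b i ^+ 2)
     - (\sum_i w i * (a i * b i)) ^+ 2) by move: h; lra.
rewrite expr2 !big_distrlr /= -sumrB mulr_natl mulr2n.
rewrite [X in _ = X + _](_ : _ = \sum_i \sum_j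
  (w i * w j * (a i ^+ 2 * b j ^+ 2 - a i * b i * (a j * b j)))); last first.
  by apply: eq_bigr => i _; rewrite -sumrB; apply: eq_bigr => j _; ring.
rewrite [X in _ = _ + X](_ : _ = \sum_i \sum_j
  (w i * w j * (a j ^+ 2 * b i ^+ 2 - a i * b i * (a j * b j)))); last first.
  rewrite [RHS]exchange_big; apply: eq_bigr => i _ /=.
  by rewrite -sumrB; apply: eq_bigr => j _; ring.
rewrite -big_split; apply: eq_bigr => i _; rewrite -big_split /=.
by apply: eq_bigr => j _; ring.
Qed.

(** An equality for equal signs, and u^2 + v^2 <= (|u| + |v|)^2 for opposite ones. Because it holds
    across zero, f|f| treats both sides of the median at once. *)
Lemma norm_signed_sqrB (u v : R) :
  `|u * `|u| - v * `|v| | <= `|u - v| * (`|u| + `|v|).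
Proof.
have -> : u * `|u| - v * `|v| =
    ((u - v) * (`|u| + `|v|) + (u + v) * (`|u| - `|v|)) / 2 by field.
rewrite normrM normfV normr_nat ler_pdivrMr // mulr_natr mulr2n.
apply: le_trans (ler_normD _ _) _; rewrite !normrM lerD //.
  by rewrite [leLHS]mulrC (ger0_norm (addr_ge0 _ _)) // mulrC.
by rewrite mulrC ler_pM // ?lerB_dist ?ler_normD //; exact: ler_dist_dist.
Qed.

(** A pair consists of a threshold and the gap to the next value. The gaps whose threshold is below
    [x] telescope from [y] to [x]; the comparison is strict, so the gap that starts at [x] is left
    out. *)
Lemma sorted_layers (y : R) (s : seq R) (x : R) :
  path <=%O y s -> x \in y :: s ->
  \sum_(p <- pairmap (fun u v => (u, v - u)) y s) p.2 * (p.1 < x)%R%:R = x - y.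
Proof.
elim: s y => [|z s IH] y /=.
  by move=> _; rewrite inE => /eqP ->; rewrite big_nil subrr.
move=> /andP[yz pz]; rewrite inE big_cons /= => xs.
have [xys|xy] := boolP (x \in z :: s).
  have zx : z <= x.
    move: xys; rewrite inE => /orP[/eqP-> //|xs'].
    by move: pz => /order_path_min-/(_ le_trans)/allP; apply.
  rewrite IH //; have [yx|xy] := ltP y x; rewrite ?mulr1 ?mulr0; first by ring.
  by have -> : x = z; [apply: le_anti; rewrite zx (le_trans xy) | rewrite (le_anti (_ : z <= y <= z)) ?yz ?(le_trans zx xy) //; ring].
move: xs; rewrite (negPf xy) orbF => /eqP xE.
rewrite xE ltxx mulr0 add0r subrr big1_seq // => p /andP[_ ps].
suff : y <= p.1 by move=> /le_gtF->; rewrite mulr0.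
have : y <= z by []; move: ps {xy IH xE}.
elim: s z pz {yz} => [//|z' s IH] z /= /andP[zz' pz']; rewrite inE => /orP[/eqP -> //|ps] yz.
by apply: (IH z') => //; apply: le_trans zz'.
Qed.

(** A difference of indicators has values in {-1, 0, 1}, so its square is its absolute value. The
    square is written because, summed against weights, it is the Dirichlet form of a level set. *)
Lemma layer_cake (n : nat) (g : 'I_n -> R) :
  exists s : seq (R * R), (forall p, p \in s -> 0 <= p.2) /\
    forall k l, `|g k - g l| =
      \sum_(p <- s) p.2 * ((p.1 < g k)%R%:R - (p.1 < g l)%R%:R) ^+ 2.
Proof.
case E : (sort <=%O (codom g)) => [|y s].
  exists [::]; split=> // k; have := codom_f g k.
  by rewrite -(mem_sort <=%O) E.
have py : path <=%O y s.
  by have := sort_sorted le_total (codom g); rewrite E.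
exists (pairmap (fun u v => (u, v - u)) y s); split.
  elim: s y py {E} => [//|z s IH] y /= /andP[yz pz] p; rewrite inE => /orP[/eqP->|].
    by rewrite subr_ge0.
  exact: IH.
have gE k : \sum_(p <- pairmap (fun u v => (u, v - u)) y s) p.2 * (p.1 < g k)%R%:R = g k - y.
  by apply: sorted_layers => //; rewrite -E mem_sort codom_f.
have wl k l : g l <= g k -> `|g k - g l| =
      \sum_(p <- pairmap (fun u v => (u, v - u)) y s) p.2 * ((p.1 < g k)%R%:R - (p.1 < g l)%R%:R) ^+ 2.
  move=> lk; rewrite ger0_norm ?subr_ge0 //.
  transitivity ((g k - y) - (g l - y)); first by ring.
  rewrite -!gE -sumrB; apply: eq_bigr => p _; rewrite -mulrBr; congr (_ * _).
  have [pl|pl] := ltP p.1 (g l); first by rewrite (lt_le_trans pl lk) subrr expr0n.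
  by case: ltP; rewrite subr0 ?expr1n ?expr0n.
move=> k l; have [|/ltW] := leP (g l) (g k); first exact: wl.
move=> /wl; rewrite distrC => ->; apply: eq_bigr => p _.
by rewrite -sqrrN opprB.
Qed.

(** The witness has the smallest value at which the cumulative weight reaches 1/2. Were more than
    1/2 strictly below it, the largest value below would already qualify. *)
Lemma weighted_median (n : nat) (wt x : 'I_n -> R) :
    (forall k, 0 <= wt k) -> \sum_k wt k = 1 ->
  exists m, \sum_(k | x k < x m) wt k <= 2^-1 /\ \sum_(k | x m < x k) wt k <= 2^-1.
Proof.
move=> w0 w1.
have [k0 _|n0] := pickP 'I_n; last first.
  by move: w1; rewrite big1 => [/esym/eqP|i]; [rewrite oner_eq0 | have := n0 i].
pose F k := \sum_(j | x j <= x k) wt j.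
pose top := [arg max_(k > k0) x k]%O.
have Ftop : 2^-1 <= F top.
  rewrite /F (eq_bigl xpredT) => [|j]; first by rewrite w1; lra.
  by rewrite /top; case: arg_maxP => // i _ /(_ j isT).
case: (@arg_minP _ _ _ top (fun k => 2^-1 <= F k) x Ftop) => m mF mmin.
have split_w (P : pred 'I_n) : \sum_(k | P k) wt k = 1 - \sum_(k | ~~ P k) wt k.
  by rewrite -w1 [X in _ = X - _](bigID P) /= addrK.
exists m; split; last first.
  rewrite split_w (eq_bigl (fun k => x k <= x m)) => [|k]; last by rewrite -leNgt.
  by move: mF; rewrite /F; lra.
rewrite leNgt; apply/negP => big.
have [j jm|none] := pickP [pred j | x j < x m]; last first.
  by move: big; rewrite big_pred0 // ltNge invr_ge0 ler0n.
case: (@arg_maxP _ _ _ j [pred j | x j < x m] x jm) => i /= im imax.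
have : 2^-1 <= F i.
  rewrite /F (eq_bigl (fun k => x k < x m)) ?ltW // => k.
  by apply/idP/idP => [ki|/imax //]; exact: le_lt_trans im.
by move/mmin; rewrite leNgt im.
Qed.

(** The last sum is the degree term of the classical proof, expressed through [Q]: the Dirichlet
    form of the indicator of k is the total weight joining k to the other points. *)
Lemma coarea_bound (n : nat) (w : 'I_n -> 'I_n -> R) (Q : ('I_n -> R) -> R)
    (a b : R) (f : 'I_n -> R) (s : seq (R * R)) :
    0 <= a -> 0 <= b -> (forall k l, 0 <= w k l) ->
    (forall f, a * (\sum_k \sum_l w k l * (f k - f l) ^+ 2) <= Q f
       <= b * (\sum_k \sum_l w k l * (f k - f l) ^+ 2)) ->
    (forall p, p \in s -> 0 <= p.2) ->
    (forall k l, `|f k * `|f k| - f l * `|f l| | =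
      \sum_(p <- s) p.2 * ((p.1 < f k * `|f k|)%R%:R - (p.1 < f l * `|f l|)%R%:R) ^+ 2) ->
  (a * \sum_(p <- s) p.2 * Q (fun k => (p.1 < f k * `|f k|)%R%:R)) ^+ 2 <=
  2 * b ^+ 2 * Q f * \sum_k f k ^+ 2 * Q (fun l => (l == k)%:R).
Proof.
move=> a0 b0 w0 hQ s0 hs.
pose W f := \sum_k \sum_l w k l * (f k - f l) ^+ 2.
have hQ' f' : a * W f' <= Q f' /\ Q f' <= b * W f' by apply/andP/hQ.
have W0 f' : 0 <= W f'.
  by apply: sumr_ge0 => k _; apply: sumr_ge0 => l _; rewrite mulr_ge0 ?sqr_ge0.
have Q0 f' : 0 <= Q f' by apply: le_trans (hQ' f').1; rewrite mulr_ge0.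
pose G := \sum_k \sum_l w k l * `|f k * `|f k| - f l * `|f l| |.
have layersG : \sum_(p <- s) p.2 * W (fun k => (p.1 < f k * `|f k|)%R%:R) = G.
  rewrite /G; under [RHS]eq_bigr => k _ do under eq_bigr => l _ do rewrite hs mulr_sumr.
  under [RHS]eq_bigr => k _ do rewrite exchange_big /=.
  rewrite [RHS]exchange_big /=; apply: eq_bigr => p _; rewrite mulr_sumr.
  by apply: eq_bigr => k _; rewrite mulr_sumr; apply: eq_bigr => l _; rewrite mulrCA.
have QG : 0 <= \sum_(p <- s) p.2 * Q (fun k => (p.1 < f k * `|f k|)%R%:R) <= b * G.
  apply/andP; split.
    by rewrite big_seq; apply: sumr_ge0 => p ps; rewrite mulr_ge0 ?s0.
  rewrite -layersG mulr_sumr big_seq [leRHS]big_seq; apply: ler_sum => p ps.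
  by rewrite mulrCA ler_wpM2l ?s0 //; have [] := hQ' (fun k => (p.1 < f k * `|f k|)%R%:R).
pose H := \sum_k f k ^+ 2 * W (fun l => (l == k)%:R).
(* [w] need not be symmetric, so the degree of k collects its row and its column; the diagonal
   weights cancel. *)
have HE : H = \sum_k \sum_l w k l * ((f k ^+ 2 + f l ^+ 2) *+ (k != l)).
  rewrite /H; under eq_bigr do rewrite /W mulr_sumr.
  rewrite exchange_big; apply: eq_bigr => k _ /=.
  under eq_bigr do rewrite mulr_sumr.
  rewrite exchange_big; apply: eq_bigr => l _ /=.
  under eq_bigr do rewrite mulrCA; rewrite -mulr_sumr; congr (_ * _).
  have [->|kl] := eqVneq k l; first by rewrite mulr0n big1 // => i _; rewrite subrr expr0n mulr0.
  rewrite mulr1n (bigD1 k) //= (bigD1 l) 1?eq_sym //= big1 ?addr0 => [|i /andP[ik il]].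
    by rewrite !eqxx (negPf kl) subr0 sub0r sqrrN expr1n !mulr1.
  by rewrite (eq_sym k) (negPf ik) (eq_sym l) (negPf il) subrr expr0n mulr0.
(* Cauchy-Schwarz over pairs. Since [H] has no diagonal terms, |f k| + |f l| is cut off at k = l,
   which is harmless because |f k - f l| vanishes there. *)
have GWH : G ^+ 2 <= W f * (2 * H).
  have nn k l : 0 <= (`|f k| + `|f l|) *+ (k != l) by rewrite mulrn_wge0 ?addr_ge0.
  have GB : 0 <= G <= \sum_(p : 'I_n * 'I_n)
      w p.1 p.2 * (`|f p.1 - f p.2| * ((`|f p.1| + `|f p.2|) *+ (p.1 != p.2))).
    apply/andP; split; first by apply: sumr_ge0 => k _; apply: sumr_ge0 => l _; rewrite mulr_ge0.
    rewrite -(pair_bigA _ (fun k l =>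
      w k l * (`|f k - f l| * ((`|f k| + `|f l|) *+ (k != l))))) /=.
    apply: ler_sum => k _; apply: ler_sum => l _; rewrite ler_wpM2l //.
    have [->|_] := eqVneq k l; first by rewrite subrr normr0 mulr0n mulr0.
    exact: norm_signed_sqrB.
  case/andP: GB => G0 GB.
  apply: (@le_trans _ _ (_ ^+ 2)); first by rewrite ler_sqr ?nnegrE; [exact: GB| |exact: le_trans GB].
  apply: le_trans (weighted_cauchy_schwarz _ _ (fun p => w0 p.1 p.2)) _.
  have -> : \sum_p w p.1 p.2 * `|f p.1 - f p.2| ^+ 2 = W f.
    rewrite /W pair_bigA; apply: eq_bigr => p _.
    by rewrite real_normK ?num_real.
  rewrite ler_wpM2l // HE pair_bigA mulr_sumr; apply: ler_sum => -[k l] _ /=.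
  rewrite [leRHS]mulrCA ler_wpM2l //; case: eqP => _; first by rewrite !mulr0n expr0n mulr0.
  rewrite !mulr1n -(real_normK (num_real (f k))) -(real_normK (num_real (f l))).
  by have := sqr_ge0 (`|f k| - `|f l|); nra.
have H0 : 0 <= H by apply: sumr_ge0 => k _; rewrite mulr_ge0 ?sqr_ge0.
have aH : a * H <= \sum_k f k ^+ 2 * Q (fun l => (l == k)%:R).
  rewrite mulr_sumr; apply: ler_sum => k _; rewrite mulrCA ler_wpM2l ?sqr_ge0 //.
  by have [] := hQ' (fun l => (l == k)%:R).
case/andP: QG => S0 SG.
have aW := (hQ' f).1.
set S := \sum_(p <- s) _ in S0 SG *.
set T := \sum_k _ in aH *.
have e1 : S ^+ 2 <= b ^+ 2 * (W f * (2 * H)).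
  apply: (@le_trans _ _ ((b * G) ^+ 2)); first by rewrite ler_sqr ?nnegrE ?(le_trans S0).
  by rewrite exprMn ler_wpM2l ?sqr_ge0.
rewrite exprMn; apply: (@le_trans _ _ (2 * b ^+ 2 * (a * W f) * (a * H))).
  have -> : 2 * b ^+ 2 * (a * W f) * (a * H) = a ^+ 2 * (b ^+ 2 * (W f * (2 * H))) by ring.
  by rewrite ler_wpM2l ?sqr_ge0.
rewrite -[leLHS]mulrA -[leRHS]mulrA; apply: ler_wpM2l.
  by rewrite mulr_ge0 ?sqr_ge0.
by apply: ler_pM => //; exact: mulr_ge0.
Qed.

(** [Q] is abstract here, since the limit form comes with no weights: the coarea inequality is
    assumed in the shape that survives the limit. With Z the second moment about the median, it
    gives (a h Z)^2 <= 2 b^2 Q(f) M Z, and one factor Z cancels. *)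
Lemma cheeger_real (n : nat) (Q : ('I_n -> R) -> R) (wt x : 'I_n -> R)
    (a b h M : R) :
    0 < a -> 0 <= h -> 0 <= M -> (forall f, 0 <= Q f) ->
    (forall k, 0 <= wt k) -> \sum_k wt k = 1 ->
    (forall f s, (forall p, p \in s -> 0 <= p.2) ->
      (forall k l, `|f k * `|f k| - f l * `|f l| | =
        \sum_(p <- s) p.2 * ((p.1 < f k * `|f k|)%R%:R - (p.1 < f l * `|f l|)%R%:R) ^+ 2) ->
      (a * \sum_(p <- s) p.2 * Q (fun k => (p.1 < f k * `|f k|)%R%:R)) ^+ 2 <=
      2 * b ^+ 2 * Q f * \sum_k f k ^+ 2 * Q (fun l => (l == k)%:R)) ->
    (forall A : pred 'I_n,
      h * Num.min (\sum_(k | A k) wt k) (1 - \sum_(k | A k) wt k)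
        <= Q (fun k => (A k)%:R)) ->
    (forall k, Q (fun l => (l == k)%:R) <= M * wt k) ->
  exists m, h ^+ 2 * a ^+ 2 * \sum_k wt k * (x k - m) ^+ 2
    <= 2 * b ^+ 2 * M * Q (fun k => x k - m).
Proof.
move=> a0 h0 M0 Q0 wt0 wt1 hco hcut hM.
have [m [mlo mhi]] := weighted_median x wt0 wt1.
exists (x m); pose f k := x k - x m; pose g k := f k * `|f k|.
have gm : g m = 0 by rewrite /g /f subrr mul0r.
have g_lt0 k : g k < 0 -> x k < x m.
  by rewrite -[x k < _]subr_lt0 -/(f k) /g; apply: contraTT; rewrite -!leNgt => fk; rewrite mulr_ge0.
have g_gt0 k : 0 < g k -> x m < x k.
  rewrite -[x m < _]subr_gt0 -/(f k) /g; apply: contraTT; rewrite -!leNgt => fk.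
  by rewrite mulr_le0_ge0.
have [s [s0 hs]] := layer_cake g.
have := hco f s s0 hs; rewrite -/(g _).
set Z := \sum_k wt k * (x k - x m) ^+ 2.
have Z0 : 0 <= Z by apply: sumr_ge0 => k _; rewrite mulr_ge0 ?sqr_ge0.
set S := \sum_(p <- s) _; set T := \sum_k _.
have TZ : T <= M * Z.
  rewrite /T /Z mulr_sumr; apply: ler_sum => k _.
  by rewrite mulrC mulrA ler_wpM2r ?sqr_ge0.
have SZ : h * Z <= S.
  have -> : Z = \sum_k wt k * `|g k - g m|.
    apply: eq_bigr => k _; rewrite gm subr0 /g normrM normr_id -expr2.
    by rewrite real_normK ?num_real.
  under eq_bigr => k _ do rewrite hs mulr_sumr.
  rewrite exchange_big mulr_sumr /S big_seq [leRHS]big_seq; apply: ler_sum => p ps.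
  under eq_bigr => k _ do rewrite mulrCA.
  rewrite -mulr_sumr mulrCA ler_wpM2l ?s0 //; apply: le_trans (hcut (fun k => p.1 < g k)).
  rewrite ler_wpM2l //.
  have compl : 1 - \sum_(k | p.1 < g k) wt k = \sum_(k | ~~ (p.1 < g k)) wt k.
    by rewrite -wt1 [X in X - _](bigID (fun k => p.1 < g k)) /= addrAC subrr add0r.
  have half (P P' : pred 'I_n) : (forall k, P k -> P' k) ->
      \sum_(k | P' k) wt k <= 2^-1 -> \sum_(k | P k) wt k <= 2^-1.
    move=> PP'; apply: le_trans; rewrite [leRHS](bigID P) /= -[leLHS]addr0.
    apply: lerD; last exact: sumr_ge0.
    by rewrite le_eqVlt; apply/orP; left; apply/eqP/eq_bigl => k; case: (boolP (P k)) => [/PP'->|_]; rewrite ?andbF.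
  (* Since g(m) = 0, the side of the cut that misses the median is the lower one for a negative
     level and the upper one otherwise. It carries at most half of the weight, hence realizes the
     minimum. *)
  rewrite gm; have [p0|p0] := ltP p.1 0.
    have -> : \sum_k wt k * ((p.1 < g k)%R%:R - true%:R) ^+ 2 = 1 - \sum_(k | p.1 < g k) wt k.
      rewrite compl [RHS]big_mkcond; apply: eq_bigr => k _.
      by case: (p.1 < g k); rewrite /= ?subrr ?expr0n ?mulr0 // sub0r sqrrN expr1n mulr1.
    rewrite le_min lexx andbT compl.
    have : \sum_(k | ~~ (p.1 < g k)) wt k <= 2^-1.
      by apply: half mlo => k; rewrite -leNgt => /le_lt_trans/(_ p0)/g_lt0.
    by rewrite -compl; lra.
  have -> : \sum_k wt k * ((p.1 < g k)%R%:R - false%:R) ^+ 2 = \sum_(k | p.1 < g k) wt k.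
    rewrite [RHS]big_mkcond; apply: eq_bigr => k _.
    by case: (p.1 < g k); rewrite /= subr0 ?expr0n ?mulr0 // expr1n mulr1.
  rewrite le_min lexx /=.
  have : \sum_(k | p.1 < g k) wt k <= 2^-1.
    by apply: half mhi => k /(le_lt_trans p0)/g_gt0.
  by lra.
move=> key.
have [Z1|Zle] := ltP 0 Z; last first.
  have -> : Z = 0 by apply: le_anti; rewrite Zle Z0.
  rewrite mulr0; have := mulr_ge0 (mulr_ge0 (ler0n R 2) (sqr_ge0 b)) (Q0 f) => h2.
  by rewrite [X in _ <= X]mulrAC; apply: mulr_ge0.
have : (a * (h * Z)) ^+ 2 <= 2 * b ^+ 2 * Q f * (M * Z).
  apply: le_trans (le_trans _ key) _.
    by rewrite ler_sqr ?nnegrE ?ler_wpM2l ?mulr_ge0 ?(le_trans _ SZ) ?mulr_ge0 // ltW.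
  by apply: ler_wpM2l => //; apply: mulr_ge0 (Q0 f); rewrite mulr_ge0 ?sqr_ge0.
move=> fin; rewrite -(ler_pM2r Z1); move: fin; congr (_ <= _); ring.
Qed.

End Coarea.

(** * Complete positivity, the real KMS inner product, and operator norms *)

Section Matrices.
Variable R : realType.
Local Notation C := (complex R).

(** The blocks E_i E_j^* form the rank-one positive matrix of the stacked column E. Its image under
    the n-fold amplification is tested on the stacked column v. *)
Lemma completely_positive_quadratic n (F : 'M[C]_n -> 'M[C]_n)
    (E v : 'I_n -> 'cV[C]_n) :
  completely_positive F ->
  0 <= \sum_i \sum_j ((v i)^t* *m F (E i *m (E j)^t*) *m v j) 0 0.
Proof.
move=> cp.
have quad (B : 'I_n -> 'I_n -> 'M[C]_n) (w : 'I_n -> 'cV[C]_n) :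
    (\mxcol_i w i)^t* *m (\mxblock_(i < n, j < n) B i j) *m (\mxcol_i w i)
    = \sum_i \sum_j ((w i)^t* *m B i j *m w j).
  have -> : (\mxcol_i w i)^t* = \mxrow_i (w i)^t*.
    by apply/matrixP => i j; rewrite !mxE.
  rewrite mul_mxrow_mxblock mul_mxrow_mxcol exchange_big.
  by apply: eq_bigr => j _; rewrite mulmx_suml.
have psdB : psdmx (\mxblock_(i < n, j < n) (E i *m (E j)^t*)).
  move=> w; rewrite -(submxcolK w) quad summxE.
  have -> : \sum_i (\sum_j (submxcol w i)^t* *m (E i *m (E j)^t*) *m submxcol w j) ord0 ord0
     = (\sum_i ((submxcol w i)^t* *m E i) 0 0) * (\sum_i ((submxcol w i)^t* *m E i) 0 0)^*.
    rewrite rmorph_sum big_distrlr; apply: eq_bigr => i _; rewrite summxE.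
    apply: eq_bigr => j _ /=.
    rewrite mulmxA -mulmxA mxE big_ord1 -[((_ *m E j) 0 0)^*]adjmxE adjmxM trmxCK //.
  by rewrite mul_conjC_ge0.
have := cp n _ psdB (\mxcol_i v i).
by rewrite quad summxE; congr (0 <= _); apply: eq_bigr => i _; rewrite summxE.
Qed.


Lemma Re_conjC (z : C) : complex.Re (z^*) = complex.Re z.
Proof. by case: z. Qed.

Lemma Re_ge0E (z : C) : 0 <= z -> z = ((complex.Re z)%:C)%C.
Proof. by move=> z0; rewrite RRe_real ?ger0_real. Qed.

Lemma Re_mulr (a : R) (z : C) : complex.Re ((a%:C)%C * z) = a * complex.Re z.
Proof. by case: z => x y /=; rewrite mul0r subr0. Qed.

Lemma Re_mono (x y : C) : x <= y -> complex.Re x <= complex.Re y.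
Proof. by rewrite lecE => /andP[]. Qed.

Section InnerProduct.
Variables (n : nat) (D : 'M[C]_n).
Hypothesis hD : posdefmx D.

Definition ip (X Y : 'M[C]_n) : R := complex.Re (kms_inner D X Y).

Lemma ip_linearr X Y Z (a : R) : ip X ((a%:C)%C *: Y + Z) = a * ip X Y + ip X Z.
Proof.
by rewrite /ip -[kms_inner D X _]/(kform _ _ _) kform_linearr raddfD /= Re_mulr.
Qed.

Lemma ipC X Y : ip X Y = ip Y X.
Proof.
by rewrite /ip -[kms_inner D Y X]/(kform (psqrtmx D) _ _) kformC ?psqrtmx_hermitian // Re_conjC.
Qed.

Lemma kms_inner_ge0 X : 0 <= kms_inner D X X.
Proof.
rewrite -[kms_inner D X X]/(kform (psqrtmx D) X X) kform_psqrtE //.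
apply: sumr_ge0 => i _; apply: sumr_ge0 => j _.
by rewrite mulr_ge0 ?exprn_ge0 // mulr_ge0 // ltW // sv_gt0.
Qed.

Lemma ip_ge0 X : 0 <= ip X X.
Proof. exact: (Re_mono (kms_inner_ge0 X)). Qed.

Lemma kms_norm_sqr X : kms_norm D X ^+ 2 = ip X X.
Proof. by rewrite sqr_sqrtr // ip_ge0. Qed.

Lemma ip_linearl X Y Z (a : R) : ip ((a%:C)%C *: Y + Z) X = a * ip Y X + ip Z X.
Proof. by rewrite ipC ip_linearr !(ipC X). Qed.

Lemma ip_cauchy_schwarz X Y : ip X Y ^+ 2 <= ip X X * ip Y Y.
Proof.
have q t : 0 <= ip X X + 2 * t * ip X Y + t ^+ 2 * ip Y Y.
  have := ip_ge0 ((t%:C)%C *: Y + X); rewrite (ip_linearr (_ *: _ + _) Y X t).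
  rewrite (ip_linearl Y Y X t) (ip_linearl X Y X t) (ipC Y X).
  move: (ip X X) (ip X Y) (ip Y Y) => a b c.
  by congr (0 <= _); ring.
have := ip_ge0 Y; have := ip_ge0 X; move: (ip X X) (ip X Y) (ip Y Y) q => a b c q a0 c0.
have [c0'|cn0] := eqVneq c 0.
  rewrite c0' mulr0; have [->|bn0] := eqVneq b 0; first by rewrite expr0n.
  (* With c = 0 the quadratic is affine in t, and this t gives it the value -1. *)
  have := q (- (a + 1) / (2 * b)); rewrite c0' mulr0 addr0.
  have -> : 2 * (- (a + 1) / (2 * b)) * b = - (a + 1) by field.
  by lra.
have cp : 0 < c by rewrite lt_def cn0.
have := q (- b / c).
have -> : a + 2 * (- b / c) * b + (- b / c) ^+ 2 * c = (a * c - b ^+ 2) / c by field.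
by rewrite pmulr_lge0 ?invr_gt0 // subr_ge0.
Qed.

End InnerProduct.

Definition modulus (z : C) : R := complex.Re `|z|.

Lemma modulusE z : `|z| = ((modulus z)%:C)%C.
Proof. exact: Re_ge0E. Qed.

Lemma modulus_ge0 z : 0 <= modulus z.
Proof. exact: (Re_mono (normr_ge0 z)). Qed.

Lemma modulusM z w : modulus (z * w) = modulus z * modulus w.
Proof. by rewrite /modulus normrM !modulusE -rmorphM. Qed.

Lemma modulus_sum (I : finType) (F : I -> C) :
  modulus (\sum_i F i) <= \sum_i modulus (F i).
Proof.
have := Re_mono (ler_norm_sum (index_enum I) F predT).
by rewrite raddf_sum.
Qed.

Lemma hs_norm_ge0 n (X : 'M[C]_n) : 0 <= hs_norm X.
Proof. exact: sqrtr_ge0. Qed.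

Lemma hs_norm_sqr n (X : 'M[C]_n) : hs_norm X ^+ 2 = \sum_i \sum_j modulus (X i j) ^+ 2.
Proof.
have mE z : complex.Re (`|z| ^+ 2) = modulus z ^+ 2.
  by rewrite modulusE -rmorphXn.
have -> : \sum_i \sum_j modulus (X i j) ^+ 2 = complex.Re (\tr (X^t* *m X)).
  rewrite hsE raddf_sum; apply: eq_bigr => i _; rewrite raddf_sum; apply: eq_bigr => j _.
  by rewrite -mE.
rewrite sqr_sqrtr // hsE; apply: (@Re_mono 0).
by apply: sumr_ge0 => i _; apply: sumr_ge0 => j _; rewrite exprn_ge0.
Qed.

Lemma hs_norm_entry n (X : 'M[C]_n) i j : modulus (X i j) <= hs_norm X.
Proof.
rewrite -ler_sqr ?nnegrE ?modulus_ge0 ?hs_norm_ge0 // hs_norm_sqr.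
rewrite (bigD1 i) //= (bigD1 j) //= -addrA lerDl addr_ge0 //.
  by apply: sumr_ge0 => k _; rewrite sqr_ge0.
by apply: sumr_ge0 => k _; apply: sumr_ge0 => l _; rewrite sqr_ge0.
Qed.

Lemma hs_norm_gt0 n (X : 'M[C]_n) : X != 0 -> 0 < hs_norm X.
Proof.
move=> X0; rewrite lt_def hs_norm_ge0 andbT; apply: contra X0 => /eqP h0.
apply/eqP/matrixP => i j; have := hs_norm_entry X i j; rewrite h0 mxE => m0.
have : modulus (X i j) = 0 by apply: le_anti; rewrite m0 modulus_ge0.
by move=> e; apply/eqP; rewrite -normr_eq0 modulusE e.
Qed.

Lemma linear_hs_bounded n (T : 'M[C]_n -> 'M[C]_n) : linear T ->
  exists2 K, 0 <= K & forall X, hs_norm (T X) <= K * hs_norm X.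
Proof.
move=> hT; pose F : {linear 'M[C]_n -> 'M[C]_n} :=
  HB.pack T (GRing.isLinear.Build _ _ _ _ T hT).
pose c k l := \sum_i \sum_j modulus (F (delta_mx i j) k l).
have c0 k l : 0 <= c k l by apply: sumr_ge0 => i _; apply: sumr_ge0 => j _; exact: modulus_ge0.
have entry X k l : modulus (F X k l) <= c k l * hs_norm X.
  rewrite linear_entry; apply: le_trans (modulus_sum _) _; rewrite mulr_suml.
  apply: ler_sum => i _; apply: le_trans (modulus_sum _) _; rewrite mulr_suml.
  apply: ler_sum => j _; rewrite modulusM mulrC ler_wpM2l ?modulus_ge0 //.
  exact: hs_norm_entry.
exists (Num.sqrt (\sum_k \sum_l c k l ^+ 2)); first exact: sqrtr_ge0.
move=> X; rewrite -ler_sqr ?nnegrE ?mulr_ge0 ?hs_norm_ge0 ?sqrtr_ge0 //.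
have s0 : 0 <= \sum_k \sum_l c k l ^+ 2.
  by apply: sumr_ge0 => i _; apply: sumr_ge0 => j _; exact: sqr_ge0.
rewrite exprMn (sqr_sqrtr s0) [leLHS]hs_norm_sqr mulr_suml.
apply: ler_sum => k _; rewrite mulr_suml; apply: ler_sum => l _.
by rewrite -exprMn ler_sqr ?nnegrE ?mulr_ge0 ?modulus_ge0 ?hs_norm_ge0 //; exact: entry.
Qed.

(** [K] need not be sharp: it bounds the set of quotients, so that [sup] is a true supremum. *)
Lemma opnorm_bound n (nrm : 'M[C]_n -> R) (T : 'M[C]_n -> 'M[C]_n) K :
    (forall X, X != 0 -> 0 < nrm X) -> (forall X, nrm (T X) <= K * nrm X) ->
  forall X, X != 0 -> nrm (T X) <= opnorm nrm T * nrm X.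
Proof.
move=> nrm0 TK X X0; rewrite -ler_pdivrMr ?nrm0 //.
apply: ub_le_sup; last by exists X.
exists K => _ [Y /= Y0 <-]; rewrite ler_pdivrMr ?nrm0 //; exact: TK.
Qed.

End Matrices.

(** * Remainder of the exponential series *)

Section ExpRemainder.
Variable R : realType.

Lemma sum_halves_le1 M : \sum_(k < M) (2 ^- k.+1 : R) <= 1.
Proof.
suff -> : \sum_(k < M) (2 ^- k.+1 : R) = 1 - 2 ^- M by rewrite gerBl invr_ge0 exprn_ge0.
elim: M => [|M IH]; first by rewrite big_ord0 expr0 invr1 subrr.
by rewrite big_ord_recr /= IH exprS; field; rewrite expf_neq0.
Qed.

Lemma exp2_le_fact k : (2 ^ k.+1 <= k.+2`!)%N.
Proof.
elim: k => [//|k IH]; rewrite expnS factS.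
by apply: leq_mul.
Qed.

(** After the terms k = 0 and k = 1 cancel, (tK)^2 factors out of the rest; what remains is
    dominated by sum_k 2^-(k+1) <= 1, because (k+2)! >= 2^(k+1). The bound does not depend on [N]
    and so passes to the exponential. *)
Lemma exp_series_remainder (u : nat -> R) (B K t : R) N :
    (forall k, `|u k| <= B * K ^+ k) -> 0 <= B -> 0 <= K ->
    0 <= t -> t * K <= 1 -> (2 <= N)%N ->
  `|\sum_(k < N) ((- t) ^+ k / k`!%:R) * u k - u 0 + t * u 1%N| <= B * (t * K) ^+ 2.
Proof.
move=> uB B0 K0 t0 tK; case: N => [//|[//|M]] _.
rewrite !big_ord_recl /= expr0 fact0 divr1 mul1r expr1 (_ : (bump 0 0)`! = 1%N) // divr1.
set S := \sum_(i < M) _.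
have -> : u 0 + (- t * u 1%N + S) - u 0 + t * u 1%N = S by ring.
apply: le_trans (ler_norm_sum _ _ _) _.
apply: (@le_trans _ _ (\sum_(k < M) B * (t * K) ^+ 2 * 2 ^- k.+1)).
  apply: ler_sum => k _; rewrite /bump /= !add1n.
  rewrite normrM normrM normrX normrN (ger0_norm t0) normfV normr_nat.
  apply: (@le_trans _ _ (t ^+ k.+2 / k.+2`!%:R * (B * K ^+ k.+2))).
    by rewrite ler_wpM2l // ?divr_ge0 ?exprn_ge0.
  have -> : t ^+ k.+2 / k.+2`!%:R * (B * K ^+ k.+2) =
      B * (t * K) ^+ 2 * ((t * K) ^+ k / k.+2`!%:R) by rewrite !exprMn !exprS; ring.
  rewrite ler_wpM2l ?mulr_ge0 ?sqr_ge0 //.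
  rewrite -[leRHS]mul1r ler_pM ?exprn_ge0 ?mulr_ge0 ?invr_ge0 //.
    by rewrite exprn_ile1 ?mulr_ge0.
  rewrite lef_pV2 ?posrE ?exprn_gt0 ?ltr0n ?fact_gt0 //.
  by rewrite -natrX ler_nat exp2_le_fact.
rewrite -mulr_sumr -[leRHS]mulr1 ler_wpM2l ?mulr_ge0 ?sqr_ge0 //.
exact: sum_halves_le1.
Qed.

Lemma cvg_sum_seq (T : Type) (F : set_system T) (FF : Filter F) (I : Type) (s : seq I)
    (f : I -> T -> R) (l : I -> R) :
  (forall i, f i x @[x --> F] --> l i) ->
  \sum_(i <- s) f i x @[x --> F] --> \sum_(i <- s) l i.
Proof.
move=> fl; elim: s => [|i s IH].
  rewrite big_nil; under eq_fun do rewrite big_nil; exact: cvg_cst.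
rewrite big_cons; under eq_fun do rewrite big_cons.
exact: cvgD (fl i) IH.
Qed.

End ExpRemainder.

(** * The generator as the derivative of the semigroup at time zero *)

Section Semigroup.
Variables (R : realType) (n : nat) (D : 'M[complex R]_n) (alpha beta : R).
Local Notation C := (complex R).
Hypothesis hD : posdefmx D.
Hypothesis sv_bounds : forall i j,
  ((alpha%:C)%C : C) <= sv D 0 i * sv D 0 j <= (beta%:C)%C.

Lemma hs_norm0 : hs_norm (0 : 'M[C]_n) = 0.
Proof.
apply/eqP; rewrite -sqrf_eq0 hs_norm_sqr big1 // => i _; rewrite big1 // => j _.
by rewrite mxE /modulus normr0 expr0n.
Qed.

Lemma ip_hs X : alpha * hs_norm X ^+ 2 <= ip D X X <= beta * hs_norm X ^+ 2.
Proof.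
have hs : hs_norm X ^+ 2 = complex.Re (\tr (X^t* *m X)).
  rewrite sqr_sqrtr //; apply: (@Re_mono _ 0); rewrite hsE.
  by apply: sumr_ge0 => i _; apply: sumr_ge0 => j _; rewrite exprn_ge0.
have /andP[h1 h2] := kform_hs X (spectral_unitarymx D) (psqrtmxE D)
  (fun i => ltW (sv_gt0 hD i)) sv_bounds.
by rewrite hs -!Re_mulr; apply/andP; split; apply: Re_mono.
Qed.

Lemma ip_bounded X : exists2 B, 0 <= B & forall Y, `|ip D X Y| <= B * hs_norm Y.
Proof.
(* No sign of [beta] is assumed here, hence its positive part. *)
exists (Num.sqrt (ip D X X * Num.max 0 beta)); first exact: sqrtr_ge0.
move=> Y; rewrite -ler_sqr ?nnegrE ?mulr_ge0 ?sqrtr_ge0 ?hs_norm_ge0 //.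
have b0 : 0 <= Num.max 0 beta by rewrite le_max lexx.
rewrite real_normK ?num_real // exprMn sqr_sqrtr ?mulr_ge0 ?ip_ge0 //.
apply: le_trans (ip_cauchy_schwarz hD X Y) _; rewrite -mulrA ler_wpM2l ?ip_ge0 //.
have /andP[_ h] := ip_hs Y; apply: le_trans h _.
by rewrite ler_wpM2r ?sqr_ge0 // le_max lexx orbT.
Qed.

Section Generator.
Variables (Phi : R -> {linear 'M[C]_n -> 'M[C]_n}) (L : {linear 'M[C]_n -> 'M[C]_n}).
Hypothesis hL : is_generator Phi L.

Lemma ip0r X : ip D X 0 = 0.
Proof.
have := ip_linearr D X 0 0 1; rewrite scaler0 addr0 mul1r.
by move/eqP; rewrite -[X in X == _]addr0 (inj_eq (addrI _)) eq_sym => /eqP.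
Qed.

Lemma ip_sumr X N (a : 'I_N -> R) (Y : 'I_N -> 'M[C]_n) :
  ip D X (\sum_k ((a k)%:C)%C *: Y k) = \sum_k a k * ip D X (Y k).
Proof.
elim: N a Y => [|N IH] a Y; first by rewrite !big_ord0 ip0r.
by rewrite !big_ord_recr /= addrC (ip_linearr D X (Y ord_max) _ (a ord_max)) IH addrC.
Qed.

Lemma ipBr X Y Z : ip D X (Y - Z) = ip D X Y - ip D X Z.
Proof.
have := ip_linearr D X Z (Y - Z) 1; rewrite scale1r addrC subrK mul1r => ->.
by rewrite addrAC subrr add0r.
Qed.

Lemma generator_remainder X Y : exists c delta, 0 < delta /\ forall t, 0 <= t <= delta ->
  `|ip D X (Phi t Y) - ip D X Y + t * ip D X (L Y)| <= c * t ^+ 2.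
Proof.
have [K K0 LK] := linear_hs_bounded (linearP L).
have [B B0 XB] := ip_bounded X.
have iterK k : hs_norm (iter k L Y) <= K ^+ k * hs_norm Y.
  elim: k => [|k IH] /=; first by rewrite expr0 mul1r.
  by apply: le_trans (LK _) _; rewrite exprS -mulrA ler_wpM2l.
(* This choice of delta ensures t K <= 1, also when K = 0. *)
exists (B * hs_norm Y * K ^+ 2), (K + 1)^-1; split; first by rewrite invr_gt0 ltr_wpDl.
move=> t /andP[t0 tK].
have tK1 : t * K <= 1.
  apply: (@le_trans _ _ ((K + 1)^-1 * (K + 1))).
    by rewrite ler_pM // lerDl.
  by rewrite mulVf // gt_eqF // ltr_wpDl.
have lin_S N : linear (fun X => Phi t X - \sum_(k < N) ((((- t) ^+ k / k`!%:R)%:C)%C *: iter k L X)).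
  have it k : linear (iter k L).
    by elim: k => [|k IH] a U V //=; rewrite IH linearP.
  move=> a U V; rewrite linearP scalerBr scaler_sumr addrACA -opprD; congr (_ + _ - _).
  rewrite -big_split; apply: eq_bigr => k _ /=.
  by rewrite it scalerDr !scalerA [X in X *: _]mulrC.
rewrite -mulrA -exprMn (mulrC K).
(* The slack [e] absorbs the distance from [Phi t] to a partial sum of the series; the quadratic
   bound on the partial sum is uniform in its length. *)
apply/ler_addgt0Pl => e e0.
have Y1 : 0 < B * hs_norm Y + 1 by rewrite ltr_wpDl ?mulr_ge0 ?hs_norm_ge0.
have e1 : 0 < e / (B * hs_norm Y + 1) by rewrite divr_gt0.
have /cvgrPdist_le/(_ _ e1) := hL t0.
move=> [N0 _ hN0]; pose N := maxn 2 N0.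
have {hN0} := hN0 N (leq_maxr _ _); rewrite /= sub0r normrN => opN.
set T := (X in opnorm _ X) in opN.
have TY : hs_norm (T Y) <= e / (B * hs_norm Y + 1) * hs_norm Y.
  have [->|Y0] := eqVneq Y 0.
    have [KT _ TB] := linear_hs_bounded (lin_S N).
    by apply: le_trans (TB 0) _; rewrite hs_norm0 !mulr0.
  have [KT _ TB] := linear_hs_bounded (lin_S N).
  apply: le_trans (opnorm_bound (@hs_norm_gt0 R n) TB Y0) _.
  by rewrite ler_wpM2r ?hs_norm_ge0 //; apply: le_trans opN; exact: ler_norm.
have uB k : `|ip D X (iter k L Y)| <= B * hs_norm Y * K ^+ k.
  by apply: le_trans (XB _) _; rewrite -mulrA ler_wpM2l // mulrC.
have main := exp_series_remainder uB (mulr_ge0 B0 (hs_norm_ge0 Y)) K0 t0 tK1 (leq_maxl 2 N0).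
have -> : ip D X (Phi t Y) - ip D X Y + t * ip D X (L Y) =
   ip D X (T Y) + (\sum_(k < N) ((- t) ^+ k / k`!%:R) * ip D X (iter k L Y)
      - ip D X Y + t * ip D X (L Y)).
  rewrite /T ipBr ip_sumr.
  move: (ip D X (Phi t Y)) (ip D X Y) (t * _) (\sum_(k < N) _) => x y z w.
  by ring.
apply: le_trans (ler_normD _ _) _; apply: lerD; last exact: main.
apply: le_trans (XB _) _; apply: (@le_trans _ _ (B * (e / (B * hs_norm Y + 1) * hs_norm Y))).
  by rewrite ler_wpM2l.
have -> : B * (e / (B * hs_norm Y + 1) * hs_norm Y) =
   e * ((B * hs_norm Y) / (B * hs_norm Y + 1)) by ring.
rewrite -[leRHS]mulr1 ler_wpM2l ?(ltW e0) // ler_pdivrMr // mul1r lerDl ler01 //.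
Qed.

Lemma generator_cvg X Y :
  (ip D X Y - ip D X (Phi t Y)) / t @[t --> 0^'+] --> ip D X (L Y).
Proof.
have [c [d [d0 hc]]] := generator_remainder X Y.
apply/cvgrPdist_le => e e0.
have c1 : 0 < `|c| + 1 by rewrite ltr_wpDl.
near=> t.
have t0 : 0 < t by near: t; exact: nbhs_right_gt.
have td : t <= d by near: t; apply: nbhs_right_le.
have te : t <= e / (`|c| + 1) by near: t; apply: nbhs_right_le; rewrite divr_gt0.
have := hc t; rewrite (ltW t0) td => /(_ isT).
move: (ip D X Y) (ip D X (Phi t Y)) (ip D X (L Y)) => x y z h.
have -> : z - (x - y) / t = (y - x + t * z) / t by field; rewrite gt_eqF.
rewrite normrM normfV (gtr0_norm t0) ler_pdivrMr //; apply: le_trans h _.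
rewrite expr2 mulrA ler_wpM2r ?(ltW t0) //.
apply: (@le_trans _ _ ((`|c| + 1) * t)).
  by rewrite ler_wpM2r ?(ltW t0) //; apply: le_trans (ler_norm _) _; rewrite lerDl.
by rewrite mulrC -ler_pdivlMr.
Unshelve. all: by end_near.
Qed.

End Generator.
End Semigroup.

Lemma sqr_le_inv (R : realDomainType) (x y : R) : 0 <= y -> x ^+ 2 <= y ^+ 2 -> x <= y.
Proof.
move=> y0 h; apply: le_trans (ler_norm x) _.
by rewrite -ler_sqr ?nnegrE // real_normK ?num_real.
Qed.

(** * The two estimates for the generator *)

Section Cheeger.
Variables (R : realType) (n : nat) (D : 'M[complex R]_n).
Local Notation C := (complex R).
Variables (Phi : R -> {linear 'M[C]_n -> 'M[C]_n}) (L : {linear 'M[C]_n -> 'M[C]_n}).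
Hypothesis hPhi : quantum_markov_semigroup Phi.
Hypothesis hL : is_generator Phi L.
Hypothesis hL1 : L 1%:M = 0.
Hypothesis hD : faithful_state D.
Hypothesis hsym : kms_symmetric Phi D.
Variables (alpha beta : R).
Hypothesis alpha_gt0 : 0 < alpha.
Hypothesis sv_bounds : forall i j,
  ((alpha%:C)%C : C) <= sv D 0 i * sv D 0 j <= (beta%:C)%C.

Let pD : posdefmx D := hD.1.

Definition rcalc (W : 'M[C]_n) (f : 'I_n -> R) : 'M[C]_n :=
  fcalc W (fun k => ((f k)%:C)%C).

Definition dform W f := ip D (rcalc W f) (L (rcalc W f)).

Lemma form_sandwich_real (W : 'M[C]_n) t : W \is unitarymx -> 0 <= t ->
  exists w : 'I_n -> 'I_n -> R, (forall k l, 0 <= w k l) /\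
    forall f, alpha * (\sum_k \sum_l w k l * (f k - f l) ^+ 2)
      <= ip D (rcalc W f) (rcalc W f) - ip D (rcalc W f) (Phi t (rcalc W f))
      <= beta * (\sum_k \sum_l w k l * (f k - f l) ^+ 2).
Proof.
move=> uW t0.
have [w [w0 hw]] := form_sandwich (spectral_unitarymx D) (psqrtmxE D) (sv_gt0 pD)
  sv_bounds (fun E v => completely_positive_quadratic E v (qms_cp hPhi t0))
  (qms_unital hPhi t0) (hsym t0) uW.
exists (fun k l => complex.Re (w k l)); split=> [k l|f].
  exact: (Re_mono (w0 k l)).
have := hw (\row_k ((f k)%:C)%C) (rcalc W f) erefl.
have -> : \sum_k \sum_l w k l *
    `|(\row_k0 ((f k0)%:C)%C : 'rV[C]_n) 0 k - (\row_k0 ((f k0)%:C)%C : 'rV[C]_n) 0 l| ^+ 2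
    = ((\sum_k \sum_l complex.Re (w k l) * (f k - f l) ^+ 2)%:C)%C.
  rewrite rmorph_sum; apply: eq_bigr => k _; rewrite rmorph_sum; apply: eq_bigr => l _.
  rewrite !mxE -rmorphB {1}(Re_ge0E (w0 k l)) /= rmorphM rmorphXn /=.
  by rewrite real_normK // complex_real.
move=> /andP[/Re_mono h1 /Re_mono h2].
by move: h1 h2; rewrite raddfB !Re_mulr /= => -> ->.
Qed.

Lemma ipL_sym X Y : ip D X (L Y) = ip D Y (L X).
Proof.
have h1 := generator_cvg pD sv_bounds hL (X := X) (Y := Y).
have h2 := generator_cvg pD sv_bounds hL (X := Y) (Y := X).
apply: (@cvg_unique _ (@Rhausdorff R) _ _ _ _ h1).
apply: cvg_trans h2; apply: near_eq_cvg; near=> t.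
have t0 : 0 <= t by near: t; exact: nbhs_right_ge.
have e : ip D Y (Phi t X) = ip D X (Phi t Y).
  by rewrite (ipC pD Y (Phi t X)) /ip (hsym t0 X Y).
by rewrite e (ipC pD Y X).
Unshelve. all: by end_near.
Qed.

Lemma ipL_rcalc_ge0 W f : W \is unitarymx -> 0 <= ip D (rcalc W f) (L (rcalc W f)).
Proof.
move=> uW; set X := rcalc W f.
have h := generator_cvg pD sv_bounds hL (X := X) (Y := X).
have c0 : (0 : R) @[_ --> (0 : R)^'+] --> (0 : R) by exact: cvg_cst.
apply: ler_cvg_to c0 h _; near=> t.
have t0 : 0 <= t by near: t; exact: nbhs_right_ge.
have [w [w0 hw]] := form_sandwich_real uW t0.
rewrite divr_ge0 //; have /andP[h1 _] := hw f; apply: le_trans h1.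
apply: mulr_ge0; first exact: ltW.
by apply: sumr_ge0 => k _; apply: sumr_ge0 => l _; rewrite mulr_ge0 ?sqr_ge0.
Unshelve. all: by end_near.
Qed.

Lemma hermitian_rcalc X : X^t* = X ->
  exists W x, W \is unitarymx /\ X = rcalc W x.
Proof.
move=> hX; exists (spectralmx X), (fun k => complex.Re (spectral_diag X 0 k)).
split; first exact: spectral_unitarymx.
have dE : spectral_diag X = \row_k ((complex.Re (spectral_diag X 0 k))%:C)%C.
  by apply/rowP => k; rewrite mxE RRe_real // hermitian_diag_real.
by rewrite /rcalc /fcalc -dE; exact: hermitian_spectral.
Qed.

Lemma ipL_ge0 X : X^t* = X -> 0 <= ip D X (L X).
Proof. by move=> /hermitian_rcalc[W [x [uW ->]]]; exact: ipL_rcalc_ge0. Qed.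

Lemma ipL_coarea W f (s : seq (R * R)) : W \is unitarymx -> 0 <= beta ->
  (forall p, p \in s -> 0 <= p.2) ->
  (forall k l, `|f k * `|f k| - f l * `|f l| | =
    \sum_(p <- s) p.2 * ((p.1 < f k * `|f k|)%R%:R - (p.1 < f l * `|f l|)%R%:R) ^+ 2) ->
  (alpha * \sum_(p <- s) p.2 * dform W (fun k => (p.1 < f k * `|f k|)%R%:R)) ^+ 2 <=
  2 * beta ^+ 2 * dform W f * \sum_k f k ^+ 2 * dform W (fun l => (l == k)%:R).
Proof.
move=> uW b0 s0 hs; set Q := dform W.
pose q t g := (ip D (rcalc W g) (rcalc W g) - ip D (rcalc W g) (Phi t (rcalc W g))) / t.
have qQ g : q t g @[t --> (0 : R)^'+] --> Q g by exact: (generator_cvg pD sv_bounds hL (X := rcalc W g) (Y := rcalc W g)).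
have lhs : (alpha * \sum_(p <- s) p.2 * q t (fun k => (p.1 < f k * `|f k|)%R%:R)) ^+ 2
    @[t --> (0 : R)^'+] -->
    (alpha * \sum_(p <- s) p.2 * Q (fun k => (p.1 < f k * `|f k|)%R%:R)) ^+ 2.
  have l1 : alpha * \sum_(p <- s) p.2 * q t (fun k => (p.1 < f k * `|f k|)%R%:R)
    @[t --> (0 : R)^'+] -->
    alpha * \sum_(p <- s) p.2 * Q (fun k => (p.1 < f k * `|f k|)%R%:R).
    apply: cvgM; first exact: cvg_cst.
    apply: cvg_sum_seq => p; apply: cvgM; [exact: cvg_cst | exact: qQ].
  exact: (cvgM l1 l1).
have rhs : 2 * beta ^+ 2 * q t f * (\sum_k f k ^+ 2 * q t (fun l => (l == k)%:R))
    @[t --> (0 : R)^'+] -->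
    2 * beta ^+ 2 * Q f * \sum_k f k ^+ 2 * Q (fun l => (l == k)%:R).
  apply: cvgM; first by apply: cvgM; [exact: cvg_cst | exact: qQ].
  by apply: cvg_sum_seq => k; apply: cvgM; [exact: cvg_cst | exact: qQ].
apply: ler_cvg_to lhs rhs _; near=> t.
have t0 : 0 < t by near: t; exact: nbhs_right_gt.
have [w [w0 hw]] := form_sandwich_real uW (ltW t0).
apply: (@coarea_bound _ _ (fun k l => w k l / t)) => //; first exact: ltW.
  by move=> k l; rewrite divr_ge0 // ltW.
move=> g; have := hw g.
have -> : \sum_k \sum_l w k l / t * (g k - g l) ^+ 2 =
   (\sum_k \sum_l w k l * (g k - g l) ^+ 2) / t.
  rewrite mulr_suml; apply: eq_bigr => k _; rewrite mulr_suml; apply: eq_bigr => l _.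
  by rewrite mulrAC.
by rewrite !mulrA /q ler_pM2r ?invr_gt0 // ler_pM2r ?invr_gt0.
Unshelve. all: by end_near.
Qed.


(** The probability that the state gives to the k-th spectral projection of the basis [W]. *)
Definition weight (W : 'M[C]_n) k : R := complex.Re ((W *m D *m W^t*) k k).

Lemma weight_ge0 W k : W \is unitarymx -> 0 <= weight W k.
Proof. by move=> uW; apply: (@Re_mono _ 0); apply/ltW/posdef_conj_gt0. Qed.

Lemma state_rcalc W f : complex.Re (state_ev D (rcalc W f)) = \sum_k weight W k * f k.
Proof.
rewrite /state_ev trace_fcalc raddf_sum; apply: eq_bigr => k _.
by rewrite mulrC [RHS]mulrC -Re_mulr.
Qed.

Lemma state1 : state_ev D 1%:M = 1.
Proof. by rewrite /state_ev mulmx1 hD.2. Qed.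

Lemma rcalc_cst W c : W \is unitarymx -> rcalc W (fun=> c) = ((c%:C)%C)%:M.
Proof. by move=> uW; rewrite /rcalc fcalc_cst. Qed.

Lemma weight_sum W : W \is unitarymx -> \sum_k weight W k = 1.
Proof.
move=> uW; have := state_rcalc W (fun=> 1); rewrite (rcalc_cst _ uW) rmorph1 state1.
by move=> /= ->; apply: eq_bigr => k _; rewrite mulr1.
Qed.

Lemma rcalcM W f g : W \is unitarymx ->
  rcalc W f *m rcalc W g = rcalc W (fun k => f k * g k).
Proof.
move=> uW; rewrite /rcalc (fcalcM uW).
have e : (fun k => ((f k)%:C)%C * ((g k)%:C)%C) = (fun k => ((f k * g k)%:C)%C).
  by apply/funext => k; rewrite rmorphM.
by rewrite e.
Qed.

Lemma rcalc_projection W (A : pred 'I_n) : W \is unitarymx ->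
  orth_projection (rcalc W (fun k => (A k)%:R)).
Proof.
move=> uW; split.
  by apply: fcalc_hermitian => k; rewrite complex_real.
have e : (fun k => (A k)%:R * (A k)%:R) = (fun k => (A k)%:R) :> ('I_n -> R).
  by apply/funext => k; rewrite -natrM mulnb andbb.
by rewrite (rcalcM _ _ uW) e.
Qed.

Lemma projection_compl (P : 'M[C]_n) : orth_projection P -> orth_projection (1%:M - P).
Proof.
case=> Ph PP; split; first by rewrite adjmxB adjmx1 Ph.
by rewrite mulmxBl mul1mx mulmxBr mulmx1 PP subrr subr0.
Qed.

Lemma state_compl (P : 'M[C]_n) : complex.Re (state_ev D (1%:M - P)) = 1 - complex.Re (state_ev D P).
Proof. by rewrite /state_ev mulmxBr mulmx1 !raddfB /= hD.2. Qed.

Lemma projection_state_gt0 (P : 'M[C]_n) : orth_projection P -> P != 0 ->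
  0 < complex.Re (state_ev D P).
Proof.
by case=> Ph PP P0; have := state_proj_gt0 pD Ph PP P0; rewrite ltcE => /andP[].
Qed.

Lemma projection_state_ge0 P : orth_projection P -> 0 <= complex.Re (state_ev D P).
Proof.
move=> oP; have [->|P0] := eqVneq P 0; first by rewrite /state_ev mulmx0 raddf0.
exact/ltW/projection_state_gt0.
Qed.

Definition min_state P :=
  Num.min (complex.Re (state_ev D P)) (1 - complex.Re (state_ev D P)).

Lemma min_state_ge0 P : orth_projection P -> 0 <= min_state P.
Proof.
move=> oP; rewrite le_min projection_state_ge0 // -state_compl.
exact/projection_state_ge0/projection_compl.
Qed.

Lemma min_state_gt0 P : orth_projection P -> P != 0 -> P != 1%:M -> 0 < min_state P.
Proof.
move=> oP P0 P1; rewrite lt_min projection_state_gt0 // -state_compl.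
apply: projection_state_gt0; first exact: projection_compl.
by rewrite subr_eq0 eq_sym.
Qed.

Lemma conductance_elem_ge0 P : orth_projection P -> 0 <= ip D P (L P) / min_state P.
Proof. by move=> oP; rewrite divr_ge0 ?min_state_ge0 // ipL_ge0 //; case: oP. Qed.

Lemma conductance_ge0 : 0 <= conductance D L.
Proof.
rewrite /conductance; set E := (X in inf X).
(* For n <= 1 there is no projection other than 0 and 1, and the infimum takes its default value
   0. *)
have [->|/set0P E0] := eqVneq E set0; first by rewrite inf0.
apply: lb_le_inf => // _ [P [oP _ _] <-]; exact: conductance_elem_ge0.
Qed.

(** P = 0 and P = 1 are allowed, the minimum being zero there: a level set of the layer argument may
    be empty or full. *)
Lemma conductance_le P : orth_projection P -> conductance D L * min_state P <= ip D P (L P).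
Proof.
move=> oP; have LP0 : 0 <= ip D P (L P) by apply: ipL_ge0; case: oP.
have := min_state_ge0 oP; rewrite le_eqVlt => /predU1P[<-|mP]; first by rewrite mulr0.
rewrite -ler_pdivlMr //; apply: ge_inf.
  by exists 0 => _ [Q [oQ _ _] <-]; exact: conductance_elem_ge0.
exists P => //; split=> //.
  by apply: contraTneq mP => ->; rewrite /min_state /state_ev mulmx0 raddf0 lt_min ltxx.
by apply: contraTneq mP => ->; rewrite /min_state state1 subrr lt_min ltxx andbF.
Qed.

Lemma ip_gt0 X : X != 0 -> 0 < ip D X X.
Proof.
move=> X0; have /andP[h _] := ip_hs pD sv_bounds X; apply: lt_le_trans h.
by rewrite mulr_gt0 ?exprn_gt0 ?hs_norm_gt0.
Qed.

Lemma kms_norm_gt0 X : X != 0 -> 0 < kms_norm D X.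
Proof. by move=> X0; rewrite sqrtr_gt0; exact: ip_gt0. Qed.

Lemma kms_opnorm_bound X : X != 0 ->
  kms_norm D (L X) <= opnorm (kms_norm D) L * kms_norm D X.
Proof.
have [K K0 LK] := linear_hs_bounded (linearP L).
pose b := Num.max 0 beta; have b0 : 0 <= b by rewrite le_max lexx.
(* The constant compares the KMS and Hilbert-Schmidt norms twice, above through [beta] and below
   through [alpha]. *)
apply: (@opnorm_bound _ _ _ _ (Num.sqrt (b * K ^+ 2 / alpha)) kms_norm_gt0) => Y.
have k0 : 0 <= b * K ^+ 2 / alpha by rewrite divr_ge0 ?mulr_ge0 ?sqr_ge0 // ltW.
apply: sqr_le_inv; first by rewrite mulr_ge0 ?sqrtr_ge0.
have := kms_norm_sqr pD (L Y); have := kms_norm_sqr pD Y.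
move: (kms_norm D Y) (kms_norm D (L Y)) => x y xE yE.
rewrite exprMn (sqr_sqrtr k0) xE yE.
have /andP[_ h2] := ip_hs pD sv_bounds (L Y); apply: le_trans h2 _.
apply: (@le_trans _ _ (b * (K * hs_norm Y) ^+ 2)).
  apply: (@le_trans _ _ (b * hs_norm (L Y) ^+ 2)).
    by rewrite ler_wpM2r ?sqr_ge0 // le_max lexx orbT.
  by rewrite ler_wpM2l // ler_sqr ?nnegrE ?mulr_ge0 ?hs_norm_ge0.
have /andP[h1 _] := ip_hs pD sv_bounds Y.
rewrite exprMn mulrA -[_ / alpha * _]mulrA ler_wpM2l ?mulr_ge0 ?sqr_ge0 //.
by rewrite mulrC ler_pdivlMr // mulrC.
Qed.

Lemma opnorm_ge0 : (0 < n)%N -> 0 <= opnorm (kms_norm D) L.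
Proof.
move=> n0; have I0 : (1%:M : 'M[C]_n) != 0.
  apply/eqP => /matrixP/(_ (Ordinal n0) (Ordinal n0)); rewrite !mxE eqxx => /eqP.
  by rewrite oner_eq0.
rewrite -(pmulr_lge0 _ (kms_norm_gt0 I0)).
by apply: le_trans (kms_opnorm_bound I0); exact: sqrtr_ge0.
Qed.

Lemma ipL_le_opnorm X : ip D X (L X) <= opnorm (kms_norm D) L * ip D X X.
Proof.
have [->|X0] := eqVneq X 0; first by rewrite raddf0 ip0r mulr0.
have M0 : 0 <= opnorm (kms_norm D) L.
  rewrite -(pmulr_lge0 _ (kms_norm_gt0 X0)).
  by apply: le_trans (kms_opnorm_bound X0); exact: sqrtr_ge0.
apply: sqr_le_inv; first by rewrite mulr_ge0 // (ip_ge0 pD).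
apply: le_trans (ip_cauchy_schwarz pD X (L X)) _.
have := kms_opnorm_bound X0; have := kms_norm_sqr pD (L X); have := kms_norm_sqr pD X.
have := sqrtr_ge0 _ : 0 <= kms_norm D (L X).
move: (opnorm _ _) M0 (ip_ge0 pD X) (ip D (L X) (L X)) => M M0.
move: (ip D X X) (kms_norm D X) (kms_norm D (L X)) => a x y a0 b y0 xa yb yx.
have h : b <= M ^+ 2 * a by rewrite -xa -yb -exprMn lerXn2r ?nnegrE // (le_trans y0).
have -> : (M * a) ^+ 2 = a * (M ^+ 2 * a) by ring.
by rewrite ler_wpM2l.
Qed.

(** [L] kills the identity on the right, and by symmetry also on the left. *)
Lemma ipL_shift X m : let Y := X - ((m%:C)%C)%:M in ip D Y (L Y) = ip D X (L X).
Proof.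
have e1 : ((m%:C)%C)%:M = (m%:C)%C *: 1%:M :> 'M[C]_n by rewrite scalemx1.
have LY : L (X - ((m%:C)%C)%:M) = L X by rewrite e1 linearB linearZ /= hL1 scaler0 subr0.
rewrite /= LY (ipC pD) ipBr e1 -[(m%:C)%C *: 1%:M]addr0 ip_linearr ip0r addr0.
by rewrite (ipC pD _ 1%:M) (ipL_sym 1%:M X) hL1 ip0r mulr0 subr0 (ipC pD).
Qed.

(** Pythagoras: <1, X> = rho(X) = 0. This is what allows the median to replace the mean. *)
Lemma ip_shift_ge X m : state_ev D X = 0 ->
  ip D X X <= ip D (X - ((m%:C)%C)%:M) (X - ((m%:C)%C)%:M).
Proof.
move=> X0; have i1 : ip D 1%:M X = 0.
  by rewrite /ip -[kms_inner _ _ _]/(kform (psqrtmx D) 1%:M X) kform1X // -[\tr _]/(state_ev D X) X0.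
have -> : X - ((m%:C)%C)%:M = (((- m)%:C)%C : C) *: 1%:M + X.
  by rewrite rmorphN scaleNr scalemx1 addrC.
rewrite (ip_linearr _ (_ *: _ + _) 1%:M X (- m)) (ip_linearl pD 1%:M 1%:M X).
rewrite (ip_linearl pD X 1%:M X) (ipC pD X 1%:M) i1.
have := ip_ge0 pD 1%:M; move: (ip D 1%:M 1%:M) (ip D X X) => a b a0.
by have := mulr_ge0 (sqr_ge0 m) a0; nra.
Qed.

Lemma gap_lower X : (0 < n)%N -> 0 <= beta -> X^t* = X -> state_ev D X = 0 ->
  conductance D L ^+ 2 * alpha ^+ 2 * ip D X X
    <= 2 * beta ^+ 2 * opnorm (kms_norm D) L * ip D X (L X).
Proof.
move=> n0 b0 hX sX; have [W [x [uW XE]]] := hermitian_rcalc hX.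
have [||||||m hm] := @cheeger_real _ _ (dform W) (weight W) x alpha beta
  (conductance D L) (opnorm (kms_norm D) L) alpha_gt0 conductance_ge0 (opnorm_ge0 n0).
- by move=> f; exact: ipL_rcalc_ge0.
- by move=> k; exact: weight_ge0.
- exact: weight_sum.
- by move=> f s s0 hs; exact: ipL_coarea.
- move=> A; have := conductance_le (rcalc_projection A uW).
  rewrite /min_state state_rcalc; congr (_ * Num.min _ (1 - _) <= _).
    by rewrite [RHS]big_mkcond; apply: eq_bigr => k _; case: (A k); rewrite ?mulr1 ?mulr0.
  by rewrite [RHS]big_mkcond; apply: eq_bigr => k _; case: (A k); rewrite ?mulr1 ?mulr0.
(* For the spectral projection P_k, <P_k, L P_k> <= ||L|| ||P_k||^2 and ||P_k||^2 <= rho(P_k). *)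
- move=> k; apply: le_trans (ipL_le_opnorm _) _; rewrite ler_wpM2l ?opnorm_ge0 //.
  have [Ph PP] := rcalc_projection (pred1 k) uW.
  have := Re_mono (kform_le_trace_sqr pD Ph); rewrite PP => h; apply: le_trans h _.
  have := state_rcalc W (fun l => (pred1 k l)%:R); rewrite /state_ev => ->.
  rewrite (bigD1 k) //= eqxx mulr1 big1 ?addr0 // => l lk.
  by rewrite (negPf lk) mulr0.
have XmE : rcalc W (fun k => x k - m) = X - ((m%:C)%C)%:M.
  rewrite XE -(rcalc_cst m uW); apply: fcalcB => k.
  exact: rmorphB.
move: hm; rewrite /dform XmE ipL_shift => hm.
apply: (@le_trans _ _ (conductance D L ^+ 2 * alpha ^+ 2 *
  \sum_k weight W k * (x k - m) ^+ 2)); last exact: hm.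
apply: ler_wpM2l; first by apply: mulr_ge0; exact: sqr_ge0.
apply: le_trans (ip_shift_ge m sX) _.
have Ym : (X - ((m%:C)%C)%:M)^t* = X - ((m%:C)%C)%:M.
  by rewrite adjmxB hX adjmx_scalar conj_Creal // complex_real.
have h := Re_mono (kform_le_trace_sqr pD Ym). apply: le_trans h _.
rewrite -XmE (rcalcM _ _ uW); have := state_rcalc W (fun k => (x k - m) * (x k - m)).
by rewrite /state_ev => ->.
Qed.

(** With p = rho(P) and X = P - p, one has rho(X^2) = p (1 - p). The larger of p and 1 - p is at
    least 1/2, so 2 p (1 - p) >= min(p, 1 - p); this 2 is the one in [trace_sqr_le], and no
    numerical factor is left beside [K]. *)
Lemma gap_upper P K : orth_projection P -> P != 0 -> P != 1%:M ->
  (forall i j, sv D 0 i ^+ 2 + sv D 0 j ^+ 2 <= (K%:C)%C * (sv D 0 i * sv D 0 j)) ->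
  exists X, [/\ X^t* = X, state_ev D X = 0, min_state P <= K * ip D X X &
     ip D X (L X) = ip D P (L P)].
Proof.
move=> oP P0 P1 hK; have [Ph PP] := oP; set p := complex.Re (state_ev D P).
have sP : state_ev D P = (p%:C)%C.
  by apply: Re_ge0E; exact/ltW/(state_proj_gt0 pD Ph PP P0).
exists (P - ((p%:C)%C)%:M); set X := P - _.
have Xh : X^t* = X by rewrite adjmxB Ph adjmx_scalar conj_Creal // complex_real.
have stD c : state_ev D (c%:M) = c by rewrite /state_ev mul_mx_scalar mxtraceZ hD.2 mulr1.
have stB (A B : 'M[C]_n) : state_ev D (A - B) = state_ev D A - state_ev D B.
  by rewrite /state_ev mulmxBr raddfB.
have stZ a (A : 'M[C]_n) : state_ev D (a *: A) = a * state_ev D A.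
  by rewrite /state_ev -scalemxAr mxtraceZ.
split; [exact: Xh | by rewrite stB stD sP subrr | | exact: ipL_shift].
  have := Re_mono (trace_sqr_le pD Xh hK).
  have -> : \tr (D *m (X *m X)) = ((p - p ^+ 2)%:C)%C.
    have -> : X *m X = P - (p%:C)%C *: P - ((p%:C)%C *: P - ((p%:C)%C * (p%:C)%C)%:M).
      rewrite mulmxBl !mulmxBr PP mul_scalar_mx mul_mx_scalar mul_scalar_mx.
      by rewrite scale_scalar_mx.
    rewrite -[LHS]/(state_ev D _) !stB !stZ stD sP -!rmorphM -!rmorphB /=.
    by congr (_%:C)%C; ring.
  rewrite -rmorphMn Re_mulr /= => h; apply: le_trans h.
  rewrite /min_state -/p ge_min; have [p2|p2] := leP p 2^-1; apply/orP; [left|right].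
    have := projection_state_gt0 oP P0; rewrite -/p => p0.
    by rewrite mulr2n; nra.
  have := min_state_gt0 oP P0 P1; rewrite /min_state -/p lt_min => /andP[_ p1].
  by rewrite mulr2n; nra.
Qed.

End Cheeger.

(** * Extreme eigenvalues of the density matrix *)

Section Eigenvalues.
Variables (R : realType) (n : nat) (D : 'M[complex R]_n).
Local Notation C := (complex R).
Hypothesis hD : posdefmx D.
Hypothesis n_gt0 : (0 < n)%N.

Let sv_re i : R := complex.Re (sv D 0 i).

Lemma sv_reE i : sv D 0 i = ((sv_re i)%:C)%C.
Proof. exact/Re_ge0E/ltW/sv_gt0. Qed.

Lemma sv_re_gt0 i : 0 < sv_re i.
Proof. by have := sv_gt0 hD i; rewrite ltcE => /andP[]. Qed.

Lemma spectral_diag_sv i : spectral_diag D 0 i = ((sv_re i ^+ 2)%:C)%C.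
Proof. by rewrite -sv_sqr sv_reE rmorphXn. Qed.

Lemma real_eigenvalueP s : eigenvalue D ((s%:C)%C) -> exists i, s = sv_re i ^+ 2.
Proof.
move/(eigenvalue_spectral hD) => [k]; rewrite spectral_diag_sv => -[<-].
by exists k.
Qed.

Lemma sv_sqr_eigenvalue i : eigenvalue D (((sv_re i ^+ 2)%:C)%C).
Proof. by apply/(eigenvalue_spectral hD); exists i; rewrite spectral_diag_sv. Qed.

Lemma min_eigenvalue_le i : min_eigenvalue D <= sv_re i ^+ 2.
Proof.
apply: ge_inf; last exact: sv_sqr_eigenvalue.
by exists 0 => s /= /real_eigenvalueP[j ->]; exact: sqr_ge0.
Qed.

Lemma max_eigenvalue_ge i : sv_re i ^+ 2 <= max_eigenvalue D.
Proof.
apply: ub_le_sup; last exact: sv_sqr_eigenvalue.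
exists (\sum_j sv_re j ^+ 2) => s /= /real_eigenvalueP[j ->].
by rewrite (bigD1 j) //= lerDl sumr_ge0 // => k _; exact: sqr_ge0.
Qed.

Lemma min_eigenvalue_gt0 : 0 < min_eigenvalue D.
Proof.
pose i0 := Ordinal n_gt0.
have [m _ mmin] := @arg_minP _ _ _ i0 xpredT (fun i => sv_re i ^+ 2) isT.
apply: (@lt_le_trans _ _ (sv_re m ^+ 2)); first by rewrite exprn_gt0 ?sv_re_gt0.
apply: lb_le_inf; first by exists (sv_re m ^+ 2); exact: sv_sqr_eigenvalue.
by move=> s /= /real_eigenvalueP[j ->]; exact: mmin.
Qed.

Lemma sv_eigenvalue_bounds i j :
  (((min_eigenvalue D)%:C)%C : C) <= sv D 0 i * sv D 0 j <= ((max_eigenvalue D)%:C)%C.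
Proof.
rewrite !sv_reE -rmorphM !lecR /=.
have ai := min_eigenvalue_le i; have aj := min_eigenvalue_le j.
have bi := max_eigenvalue_ge i; have bj := max_eigenvalue_ge j.
have a0 := min_eigenvalue_gt0; have pi := sv_re_gt0 i; have pj := sv_re_gt0 j.
move: (min_eigenvalue D) (max_eigenvalue D) (sv_re i) (sv_re j) pi pj a0 ai aj bi bj
  => a b x y x0 y0 a0 ax ay xb yb.
apply/andP; split; apply: sqr_le_inv.
- by rewrite mulr_ge0 // ltW.
- by rewrite exprMn expr2 ler_pM // ltW.
- exact: le_trans (sqr_ge0 _) xb.
- by rewrite exprMn [leRHS]expr2 ler_pM // sqr_ge0.
Qed.

(** Origin of the constant: for x, y between u = s_-^(1/2) and v = s_+^(1/2), the quantity x/y + y/x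
    is largest when the ratio is extreme, that is u/v + v/u. The difference, cleared of
    denominators, factors as (v y - u x) (v x - u y). *)
Lemma sv_ratio_bound i j : let K := Num.sqrt (min_eigenvalue D / max_eigenvalue D)
    + Num.sqrt (max_eigenvalue D / min_eigenvalue D) in
  sv D 0 i ^+ 2 + sv D 0 j ^+ 2 <= ((K%:C)%C : C) * (sv D 0 i * sv D 0 j).
Proof.
rewrite /= !sv_reE -!rmorphXn -!rmorphM -rmorphD lecR.
have ai := min_eigenvalue_le i; have aj := min_eigenvalue_le j.
have bi := max_eigenvalue_ge i; have bj := max_eigenvalue_ge j.
have a0 := min_eigenvalue_gt0; have pi := sv_re_gt0 i; have pj := sv_re_gt0 j.
move: (min_eigenvalue D) (max_eigenvalue D) (sv_re i) (sv_re j) pi pj a0 ai aj bi bj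
  => a b x y x0 y0 a0 ax ay xb yb.
have b0 : 0 < b by apply: lt_le_trans xb; apply: lt_le_trans ax.
rewrite !sqrtrM ?(ltW a0) ?(ltW b0) // !sqrtrV ?(ltW a0) ?(ltW b0) //.
have u0 : 0 < Num.sqrt a by rewrite sqrtr_gt0.
have v0 : 0 < Num.sqrt b by rewrite sqrtr_gt0.
have ua := sqr_sqrtr (ltW a0); have vb := sqr_sqrtr (ltW b0).
move: (Num.sqrt a) (Num.sqrt b) u0 v0 ua vb => u v u0 v0 ua vb.
have ux : u <= x by apply: sqr_le_inv; rewrite ?ua // ltW.
have uy : u <= y by apply: sqr_le_inv; rewrite ?ua // ltW.
have xv : x <= v by apply: sqr_le_inv; rewrite ?vb // ltW.
have yv : y <= v by apply: sqr_le_inv; rewrite ?vb // ltW.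
have -> : (u / v + v / u) * (x * y) = (u ^+ 2 + v ^+ 2) * (x * y) / (u * v).
  by field; rewrite !gt_eqF.
rewrite ler_pdivlMr ?mulr_gt0 //.
have h1 : u * x <= v * y by rewrite (mulrC v); apply: ler_pM uy xv; exact: ltW.
have h2 : u * y <= v * x by rewrite (mulrC v); apply: ler_pM ux yv; exact: ltW.
rewrite -subr_ge0.
have -> : (u ^+ 2 + v ^+ 2) * (x * y) - (x ^+ 2 + y ^+ 2) * (u * v) =
   (v * y - u * x) * (v * x - u * y) by ring.
by rewrite mulr_ge0 // subr_ge0.
Qed.

Lemma max_eigenvalue_gt0 : 0 < max_eigenvalue D.
Proof.
have i0 := Ordinal n_gt0; apply: lt_le_trans (max_eigenvalue_ge i0).
by rewrite exprn_gt0 ?sv_re_gt0.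
Qed.

End Eigenvalues.

(** * Conclusion: from the estimates to the infima *)

Lemma exists_projection (R : realType) n : (2 <= n)%N ->
  exists P : 'M[complex R]_n, [/\ orth_projection P, P != 0 & P != 1%:M].
Proof.
case: n => [//|[//|n]] _; exists (delta_mx ord0 ord0); split.
- split; first by rewrite trmx_delta map_delta_mx.
  by rewrite mul_delta_mx.
- by apply/eqP => /matrixP/(_ ord0 ord0); rewrite !mxE eqxx => /eqP; rewrite oner_eq0.
- apply/eqP => /matrixP/(_ ord_max ord_max); rewrite !mxE eqxx => /esym/eqP.
  by rewrite oner_eq0.
Qed.

Lemma quotient_transfer (R : realFieldType) (K g e x m : R) :
  0 < K -> 0 < m -> m <= K * x -> 0 <= e -> g <= e / x -> g / K <= e / m.
Proof.
move=> K0 m0 mX e0 gX.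
have x0 : 0 < x by rewrite -(pmulr_rgt0 _ K0); exact: lt_le_trans mX.
rewrite ler_pdivrMr //; apply: le_trans gX _; rewrite ler_pdivrMr // -mulrA.
by rewrite -mulrA ler_peMr // mulrC ler_pdivlMr // mul1r.
Qed.

Local Open Scope complex_scope.

Theorem theorem3p6 (R : realType) (n : nat) (hn : (2 <= n)%N)
    (Phi : R -> {linear 'M[R[i]]_n -> 'M[R[i]]_n})
    (L : {linear 'M[R[i]]_n -> 'M[R[i]]_n})
    (D : 'M[R[i]]_n)
    (hPhi : quantum_markov_semigroup Phi)
    (hL : is_generator Phi L)
    (hprim : primitive_qms Phi L)
    (hD : faithful_state D)
    (hinv : invariant_state Phi D)
    (hsym : kms_symmetric Phi D) :
  conductance D L ^+ 2 * min_eigenvalue D ^+ 2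
    / (2 * max_eigenvalue D ^+ 2 * opnorm (kms_norm D) L)
    <= spectral_gap D L
  /\ spectral_gap D L
    <= (Num.sqrt (min_eigenvalue D / max_eigenvalue D)
        + Num.sqrt (max_eigenvalue D / min_eigenvalue D)) * conductance D L.
Proof.
have n_gt0 : (0 < n)%N by apply: leq_trans hn.
have pD := hD.1.
have a0 := min_eigenvalue_gt0 pD n_gt0; have b0 := max_eigenvalue_gt0 pD n_gt0.
have sb := sv_eigenvalue_bounds pD n_gt0.
have L1 : L 1%:M = 0 by apply/hprim.2; exists 1.
have hK i j := sv_ratio_bound pD n_gt0 i j.
set K := _ + _ in hK *.
have K0 : 0 < K by rewrite addr_gt0 // sqrtr_gt0 divr_gt0.
clearbody K.
have elem_ge0 X : X^t* = X -> 0 <= ip D X (L X) / kms_norm D X ^+ 2.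
  move=> hX; rewrite divr_ge0 ?sqr_ge0 //.
  exact: (ipL_ge0 hPhi hL hD hsym a0 sb hX).
have elem P : orth_projection P -> P != 0 -> P != 1%:M ->
    exists X, [/\ X != 0, X^t* = X, state_ev D X = 0,
     0 < min_state D P <= K * ip D X X & ip D X (L X) = ip D P (L P)].
  move=> oP P0 P1; have [X [hX sX mX EX]] := gap_upper hL L1 hD hsym sb oP P0 P1 hK.
  have m0 := min_state_gt0 hD oP P0 P1.
  exists X; split; [| exact: hX | exact: sX | by rewrite m0 mX | exact: EX].
  (* X = 0 would force the positive minimum of rho(P) and 1 - rho(P) to be at most 0. *)
  apply: contraTneq m0 => X0; rewrite -leNgt; move: mX.
  by rewrite X0 ip0r mulr0.
split.
  apply: lb_le_inf.
    have [P [oP P0 P1]] := exists_projection R hn.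
    have [X [X0 hX sX _ _]] := elem P oP P0 P1.
    by eexists; exists X.
  move=> _ [X [X0 hX sX] <-]; rewrite -[complex.Re _]/(ip D X (L X)).
  (* With a zero norm the quotient on the left is 0 by the convention on division, and nonnegativity
     of the form suffices. *)
  have [M0|M0] := eqVneq (opnorm (kms_norm D) L) 0.
    by rewrite M0 mulr0 invr0 mulr0; exact: elem_ge0.
  have {}M0 : 0 < opnorm (kms_norm D) L.
    by rewrite lt_def M0 (opnorm_ge0 L hD a0 sb n_gt0).
  have := gap_lower hPhi hL L1 hD hsym a0 sb n_gt0 (ltW b0) hX sX.
  have := ip_gt0 hD a0 sb X0.
  rewrite (kms_norm_sqr pD).
  move: (conductance D L) (min_eigenvalue D) (max_eigenvalue D) (opnorm _ _) (ip D X X)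
    (ip D X (L X)) b0 M0 => h a b M x e b0 M0 x0 key.
  rewrite ler_pdivlMr // mulrAC ler_pdivrMr; last by rewrite !mulr_gt0 // exprn_gt0.
  by rewrite [leRHS]mulrC.
rewrite mulrC -ler_pdivrMr //; apply: lb_le_inf.
  by have [P hP] := exists_projection R hn; eexists; exists P.
move=> _ [P [oP P0 P1] <-]; rewrite -[complex.Re (kms_inner _ _ _)]/(ip D P (L P)).
rewrite -/(min_state D P); have [X [X0 hX sX /andP[m0 mX] EX]] := elem P oP P0 P1.
have gX : spectral_gap D L <= ip D X (L X) / kms_norm D X ^+ 2.
  apply: ge_inf; last by exists X; [split; [exact: X0 | exact: hX | exact: sX] |].
  by exists 0 => _ [Y [_ hY _] <-]; exact: elem_ge0.
have e0 := ipL_ge0 hPhi hL hD hsym a0 sb hX.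
move: gX e0; rewrite EX (kms_norm_sqr pD).
move: (spectral_gap D L) (ip D P (L P)) (ip D X X) (min_state D P) m0 mX => g e x m m0 mX gX e0.
exact: quotient_transfer K0 m0 mX e0 gX.
Qed.
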